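(* (i) When $p$ is an odd integer with $p \geq 3$, $$u(W(p,np+1)) \leq \frac{n(p^2-1)}{4}$$ holds for any positive integer $n$, and $$u(W(p,np+2)) \leq \frac{n(p^2-1)}{4} + \frac{p-1}{2}$$ holds for any non-negative integer $n$. (ii) When $p$ is an even integer with $p \geq 4$, $$u(W(p,np+1)) \leq \frac{np(p-1)}{2}$$ holds for any positive integer $n$.
   Context: For positive integers $p,q$, let $B_W(p,q)$ be the braid on $p$ strands represented by $\left( \sigma_1 \sigma_2^{-1} \sigma_3 \cdots \sigma_{p-1}^{(-1)^p}\right)^q$, where $\sigma_i$ are the standard Artin generators (so $\sigma_i$ appears with exponent $(-1)^{i+1}$). For coprime integers $p \geq 3$ and $q \geq 2$, the weaving knot $W(p,q)$ is the closure of $B_W(p,q)$; it is an alternating knot. The unknotting number $u(K)$ of a knot $K$ is the minimum number of crossing changes needed to transform $K$ into the trivial knot. *)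

(* Defs.v *)
From HB Require Import structures.
From Stdlib Require Import Relation_Operators.
From mathcomp Require Import all_boot all_order all_algebra.
From mathcomp Require Import classical_sets reals.

Set Implicit Arguments.
Unset Strict Implicit.
Unset Printing Implicit Defensive.

Import Order.TTheory GRing.Theory Num.Theory.
Local Open Scope classical_set_scope.
Local Open Scope ring_scope.

(* Knots are polygonal (tame) and are represented by their point sets in R^3.
   A diagram of a knot is its image under the vertical projection to R^2. *)

Definition projxy (R : realType) (u : 'rV[R]_3) : 'rV[R]_2 :=
  \row_(i < 2) u 0 (widen_ord (leqnSn 2) i).

Section AffineGeometry.
Context {R : realType} {V : lmodType R}.
Implicit Types a b c : V.

Definition segment a b : set V :=
  [set u | exists2 t : R, 0 <= t <= 1 & u = (1 - t) *: a + t *: b].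

Definition open_segment a b : set V :=
  [set u | exists2 t : R, 0 < t < 1 & u = (1 - t) *: a + t *: b].

Definition triangle a b c : set V :=
  [set u | exists r s t : R, [/\ 0 <= r, 0 <= s, 0 <= t, r + s + t = 1
                               & u = r *: a + s *: b + t *: c]].

Definition affinely_independent a b c : Prop :=
  forall s t : R, s *: (b - a) + t *: (c - a) = 0 -> s = 0 /\ t = 0.

Fixpoint polyline a (vs : seq V) : set V :=
  if vs is b :: vs' then segment a b `|` polyline b vs' else [set a].

End AffineGeometry.

Section Knots.
Context {R : realType}.
Implicit Types (K L : set 'rV[R]_3) (a b c d e m x : 'rV[R]_3).

(* Reidemeister's Delta-move: the segment [a, b] of a polygonal knot is replaced
   by the two other sides of a nondegenerate triangle a b c that meets the
   remaining part L of the knot at most in a and b. As [a, b] need not be a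
   whole edge, subdivision is included. *)
Definition delta_move K K' : Prop :=
  exists L a b c,
    [/\ K = L `|` polyline a [:: b],
        K' = L `|` polyline a [:: c; b],
        affinely_independent a b c
      & L `&` triangle a b c `<=` [set a; b]].

(* Combinatorial equivalence of polygonal knots, i.e. PL ambient isotopy. *)
Definition isotopic : set 'rV[R]_3 -> set 'rV[R]_3 -> Prop :=
  clos_refl_sym_trans (set 'rV[R]_3) delta_move.

Definition trivial_knot K : Prop :=
  exists a b c, affinely_independent a b c /\
    isotopic K (polyline a [:: b; c; a]).

(* Exchange of over- and underpass at a double point of the diagram of K. The
   arcs a-m-b and a-m'-b have the same projection, a plane segment with projxy m
   in its interior. Over this segment the rest L of the knot has, apart from
   possibly the endpoints a and b, the single point x; it lies strictly between
   m and m' on the vertical line through them, and near x the knot is a straight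
   segment [d, e] whose projection crosses that of a-m-b transversally. *)
Definition crossing_change K K' : Prop :=
  exists L a b m m' d e x,
    [/\ K = L `|` polyline a [:: m; b] /\ K' = L `|` polyline a [:: m'; b],
        open_segment (projxy a) (projxy b) (projxy m) /\ projxy m' = projxy m,
        [/\ m <> m', open_segment m m' x, open_segment d e x
          & segment d e `<=` L],
        affinely_independent (projxy a) (projxy b) (projxy d)
      & forall u, L u -> segment (projxy a) (projxy b) (projxy u) ->
          [\/ u = a, u = b | u = x]].

Fixpoint unknotted_by (n : nat) K : Prop :=
  if n is n'.+1 then
    exists K1 K2, [/\ isotopic K K1, crossing_change K1 K2 & unknotted_by n' K2]
  else trivial_knot K.

(* u is the unknotting number of K. *)
Definition is_unknotting_number K (u : nat) : Prop :=
  unknotted_by u K /\ forall n : nat, unknotted_by n K -> (u <= n)%N.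

End Knots.

(* (i, true) stands for the Artin generator sigma_i (i >= 1), and (i, false) for
   its inverse. *)
Definition braid_word := seq (nat * bool).

Section ClosedBraids.
Variable R : realType.

Definition pt3 (x y z : R) : 'rV[R]_3 := \row_(i < 3) [:: x; y; z]`_i.

(* Strand positions are the lines x = 1, ..., p in the plane z = 0, and strands
   run in the direction of increasing y; the k-th letter of a word occupies
   k <= y <= k + 1. In sigma_i the strand going from position i to position
   i + 1 passes over (larger z) the one going from i + 1 to i, in its inverse it
   passes under. *)
Definition letter_strands (p k : nat) (l : nat * bool) : set 'rV[R]_3 :=
  let i := l.1 in
  let pt (j h : nat) := pt3 j%:R h%:R 0 in
  let mid := pt3 (i%:R + 2^-1) (k%:R + 2^-1) (if l.2 then 1 else -1) in
  polyline (pt i k) [:: mid; pt i.+1 k.+1]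
  `|` polyline (pt i.+1 k) [:: pt i k.+1]
  `|` \bigcup_(j in [set j | (1 <= j <= p)%N /\ j <> i /\ j <> i.+1])
        polyline (pt j k) [:: pt j k.+1].

(* The planar arc joining the top (j, m) to the bottom (j, 0) of position j
   around the left of the braid; these arcs are nested. *)
Definition closing_arc (m j : nat) : set 'rV[R]_3 :=
  polyline (pt3 j%:R m%:R 0)
    [:: pt3 j%:R (m%:R + j%:R) 0; pt3 (- j%:R) (m%:R + j%:R) 0;
        pt3 (- j%:R) (- j%:R) 0; pt3 j%:R (- j%:R) 0; pt3 j%:R 0 0].

(* The closure of the braid on p strands represented by w. *)
Definition braid_closure (p : nat) (w : braid_word) : set 'rV[R]_3 :=
  \bigcup_(k in [set k | (k < size w)%N])
     letter_strands p k (nth (0%N, true) w k)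
  `|` \bigcup_(j in [set j | (1 <= j <= p)%N]) closing_arc (size w) j.

(* (sigma_1 sigma_2^-1 sigma_3 ... sigma_(p-1)^(+-1))^q *)
Definition weaving_braid (p q : nat) : braid_word :=
  flatten (nseq q [seq (i, odd i) | i <- iota 1 p.-1]).

Definition weaving_knot (p q : nat) : set 'rV[R]_3 :=
  braid_closure p (weaving_braid p q).

End ClosedBraids.

Arguments letter_strands : clear implicits.
Arguments closing_arc : clear implicits.
Arguments braid_closure : clear implicits.
Arguments weaving_knot : clear implicits.

(* Main.v *)
Require Import Defs.
From Stdlib Require Import Relation_Operators.
From mathcomp Require Import all_boot all_order all_algebra.
From mathcomp Require Import boolp classical_sets reals.
From mathcomp Require Import ring lra zify.

Set Implicit Arguments.
Unset Strict Implicit.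
Unset Printing Implicit Defensive.

Import Order.TTheory GRing.Theory Num.Theory.
Local Open Scope classical_set_scope.
Local Open Scope ring_scope.

(** The braid word consists of rows; in each row one strand crosses all others,
    alternately over and under, and the positions shift cyclically. Label the
    strands 1, ..., p by their initial positions, and order them by height: the
    odd ones above the even ones and, within a parity, larger labels above smaller
    ones. Changing every crossing where the lower strand passes over makes the
    braid layered with respect to this order.

    A layered braid is determined up to isotopy by its order and its permutation:
    every strand can be lifted to a level of its own and pulled straight there
    ([lift_strand], [flatten_strands]). For np + 1 rows the permutation moves each
    strand by one position to the left, for np + 2 rows by two. The closure of the
    straight strands is then unknotted by removing its closing arcs from the
    innermost one outwards. An arc together with the strand that ends and the one
    that starts at it can be replaced by a single strand, as long as no other
    strand has a height between those of the two ([merge_strands]). The heights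
    are such that this always applies, in the case of the shift by one after a
    strand has been moved to another level ([unknot_shift1], [unknot_shift2]).

    It remains to count the changed crossings. In p consecutive rows each pair of
    strands crosses twice. If p is odd, the strand with the smaller label s of a
    pair s < t passes over both times if t - s is odd, and under both times if it
    is even. Hence a pair is wrong exactly if s is even and t is odd. There are
    (p^2 - 1) / 8 such pairs, and each of them takes two changes. If p is even, each
    strand of a pair passes over once, so that each of the p (p - 1) / 2 pairs
    takes one change, whatever the order ([block_cost_odd], [block_cost_even]).
    In the row after these blocks strand 1 crosses the other strands, over the
    even and under the odd ones, which agrees with the order ([row_cost0]). In the
    next row, for odd p, strand 2, the lowest one, passes over (p - 1) / 2 strands,
    and these crossings have to be changed ([row_cost1]). *)

(** * Segments, triangles and Delta-moves *)

Section Coordinates.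
Context {R : realType}.
Implicit Types (u v a b c : 'rV[R]_3) (L K : set 'rV[R]_3).

Definition cx u : R := u 0 (@Ordinal 3 0 isT).
Definition cy u : R := u 0 (@Ordinal 3 1 isT).
Definition cz u : R := u 0 (@Ordinal 3 2 isT).

Lemma cx_pt x y z : cx (pt3 x y z : 'rV[R]_3) = x. Proof. by rewrite /cx mxE. Qed.
Lemma cy_pt x y z : cy (pt3 x y z : 'rV[R]_3) = y. Proof. by rewrite /cy mxE. Qed.
Lemma cz_pt x y z : cz (pt3 x y z : 'rV[R]_3) = z. Proof. by rewrite /cz mxE. Qed.
Definition c_pt := (cx_pt, cy_pt, cz_pt).

Lemma pt_ext u v : cx u = cx v -> cy u = cy v -> cz u = cz v -> u = v.
Proof.
move=> ex ey ez; apply/rowP=> -[[|[|[|//]]] hi]; rewrite (bool_irrelevance hi isT).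
- exact: ex.
- exact: ey.
- exact: ez.
Qed.

Definition linear3 (f : 'rV[R]_3 -> R) :=
  forall r s u v, f (r *: u + s *: v) = r * f u + s * f v.

Lemma lin_cx : linear3 cx. Proof. by move=> r s u v; rewrite /cx !mxE. Qed.
Lemma lin_cy : linear3 cy. Proof. by move=> r s u v; rewrite /cy !mxE. Qed.
Lemma lin_cz : linear3 cz. Proof. by move=> r s u v; rewrite /cz !mxE. Qed.

Lemma lin_comb (f g : 'rV[R]_3 -> R) x y : linear3 f -> linear3 g ->
  linear3 (fun u => x * f u + y * g u).
Proof. by move=> lf lg r s u v; rewrite lf lg; ring. Qed.

Lemma linN (f : 'rV[R]_3 -> R) : linear3 f -> linear3 (fun u => - f u).
Proof. by move=> lf r s u v; rewrite lf; ring. Qed.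

Lemma lin3 f r s t a b c : linear3 f ->
  f (r *: a + s *: b + t *: c) = r * f a + s * f b + t * f c.
Proof. by move=> lf; rewrite -[r *: a + s *: b]scale1r lf lf; ring. Qed.

Lemma segment_lin f a b u : linear3 f -> segment a b u ->
  exists2 t : R, 0 <= t <= 1 & f u = (1 - t) * f a + t * f b.
Proof. by move=> lf [t ht ->]; exists t => //; rewrite lf. Qed.

Lemma segmentP a b u : segment a b u <->
  exists t : R, [/\ 0 <= t <= 1, cx u = (1 - t) * cx a + t * cx b,
    cy u = (1 - t) * cy a + t * cy b & cz u = (1 - t) * cz a + t * cz b].
Proof.
split=> [[t ht ->]|[t [ht ex ey ez]]].
  by exists t; split=> //; [exact: lin_cx|exact: lin_cy|exact: lin_cz].
by exists t => //; apply: pt_ext; rewrite ?(lin_cx,lin_cy,lin_cz).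
Qed.

Lemma triangleP a b c u : triangle a b c u <->
  exists r s t : R, [/\ 0 <= r /\ 0 <= s /\ 0 <= t, r + s + t = 1,
    cx u = r * cx a + s * cx b + t * cx c,
    cy u = r * cy a + s * cy b + t * cy c
    & cz u = r * cz a + s * cz b + t * cz c].
Proof.
split=> [[r [s [t [hr hs ht e ->]]]]|[r [s [t [[hr [hs ht]] e ex ey ez]]]]].
  by exists r, s, t; split=> //; apply: lin3; [exact: lin_cx|exact: lin_cy|exact: lin_cz].
exists r, s, t; split=> //; apply: pt_ext.
- by rewrite (lin3 _ _ _ _ _ _ lin_cx).
- by rewrite (lin3 _ _ _ _ _ _ lin_cy).
- by rewrite (lin3 _ _ _ _ _ _ lin_cz).
Qed.

Lemma segment_l a b : segment a b a.
Proof. by exists 0; rewrite ?lexx ?ler01 // subr0 scale1r scale0r addr0. Qed.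
Lemma segment_r a b : segment a b b.
Proof. by exists 1; rewrite ?lexx ?ler01 // subrr scale1r scale0r add0r. Qed.

Lemma segmentC a b : segment a b = segment b a.
Proof.
have h x y : segment x y `<=` segment y x; last by apply/seteqP; split; exact: h.
by move=> u [t /andP[t0 t1] ->]; exists (1 - t); [lra|rewrite subKr addrC].
Qed.

Lemma segment_eq a b : a = b -> segment a b = [set a].
Proof.
move=> <-; apply/seteqP; split=> u; last by move=> ->; exact: segment_l.
by move=> [t _ ->]; rewrite /= -scalerDl subrK scale1r.
Qed.

Lemma segment_sub a b c d : segment a b c -> segment a b d ->
  segment c d `<=` segment a b.
Proof.
move=> [r /andP[r0 r1] ->] [s /andP[s0 s1] ->] u [t /andP[t0 t1] ->].
exists ((1 - t) * r + t * s).
  by apply/andP; split; nra.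
by rewrite !scalerDr !scalerA addrACA -!scalerDl; congr (_ *: _ + _ *: _); ring.
Qed.

Lemma segment_split a b c : segment a b c ->
  segment a b = segment a c `|` segment c b.
Proof.
move=> hc; apply/seteqP; split=> u; last first.
  by move=> [|]; apply: segment_sub => //; [exact: segment_l|exact: segment_r].
case: hc => [r /andP[r0 r1] ->] [t /andP[t0 t1] ->].
have [tr|rt] := lerP t r.
  left; have [e|r0'] := eqVneq r 0.
    have -> : t = 0 by lra.
    rewrite subr0 scale1r scale0r addr0; exact: segment_l.
  have rp : 0 < r by rewrite lt_neqAle eq_sym r0'.
  exists (t / r).
    by rewrite divr_ge0 // ler_pdivrMr // mul1r.
  by rewrite scalerDr !scalerA addrA -scalerDl; congr (_ *: _ + _ *: _); field.
right; have rp : 0 < 1 - r by lra.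
exists ((t - r) / (1 - r)).
  by rewrite divr_ge0 ?ler_pdivrMr /= ?mul1r //; lra.
rewrite scalerDr !scalerA -addrA -scalerDl.
by congr (_ *: _ + _ *: _); field; rewrite gt_eqF.
Qed.

Lemma polyline1 a b : polyline a [:: b] = segment a b.
Proof. by apply/seteqP; split=> u /=; [case=> // ->; exact: segment_r|left]. Qed.

Lemma polyline2 a c b : polyline a [:: c; b] = segment a c `|` segment c b.
Proof. by rewrite -(polyline1 c b). Qed.

(** The triangles of Delta-moves are kept apart from the rest of a knot by linear
    functionals: where a functional attains its maximum over a triangle at a
    vertex or along an edge only, everything on the far side of that maximum can
    meet the triangle only there. *)
Lemma triangle_le f k a b c u : linear3 f -> f a <= k -> f b <= k -> f c <= k ->
  triangle a b c u -> f u <= k.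
Proof.
move=> lf ha hb hc [r [s [t [hr hs ht e ->]]]]; rewrite lin3 //.
have -> : k = r * k + s * k + t * k by rewrite -!mulrDl e mul1r.
by rewrite !lerD // ler_wpM2l.
Qed.

Lemma triangle_lt f k a b c u : linear3 f -> f a < k -> f b < k -> f c < k ->
  triangle a b c u -> f u < k.
Proof.
move=> lf ha hb hc [r [s [t [hr hs ht e ->]]]]; rewrite lin3 //.
have pos x y : 0 <= x -> y < k -> 0 <= x * (k - y) by move=> ? ?; rewrite mulr_ge0; lra.
have hra := pos _ _ hr ha; have hsb := pos _ _ hs hb; have htc := pos _ _ ht hc.
rewrite ltNge; apply/negP => hk.
have zero x y : y < k -> x * (k - y) = 0 -> x = 0.
  by move=> hy /eqP; rewrite mulf_eq0 => /orP[/eqP//|/eqP]; lra.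
have e' : r * (k - f a) + s * (k - f b) + t * (k - f c) = k - (r * f a + s * f b + t * f c).
  by rewrite [k in RHS](_ : k = (r + s + t) * k); [ring|rewrite e mul1r].
have r0 : r = 0 by apply: (zero _ _ ha); lra.
have s0 : s = 0 by apply: (zero _ _ hb); lra.
have t0 : t = 0 by apply: (zero _ _ hc); lra.
lra.
Qed.

Lemma triangle_vertex f a b c u : linear3 f -> f b < f a -> f c < f a ->
  triangle a b c u -> f a <= f u -> u = a.
Proof.
move=> lf hb hc [r [s [t [hr hs ht e ->]]]]; rewrite lin3 // => h.
have [s0 t0] : s = 0 /\ t = 0 by split; nra.
have r1 : r = 1 by lra.
by rewrite r1 s0 t0 scale1r !scale0r !addr0.
Qed.

Lemma triangle_edge f a b c u : linear3 f -> f b <= f a -> f c < f a ->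
  triangle a b c u -> f a <= f u -> segment a b u.
Proof.
move=> lf hb hc [r [s [t [hr hs ht e ->]]]]; rewrite lin3 // => h.
have t0 : t = 0 by nra.
exists s; first by lra.
have -> : 1 - s = r by lra.
by rewrite t0 scale0r addr0.
Qed.

Lemma triangleAC a b c : triangle a b c = triangle a c b.
Proof.
have h x y : triangle a x y `<=` triangle a y x; last by apply/seteqP; split; exact: h.
move=> u [r [s [t [hr hs ht e ->]]]]; exists r, t, s.
by split; rewrite // addrAC.
Qed.

Lemma triangleC a b c : triangle a b c = triangle b a c.
Proof.
have h x y : triangle x y c `<=` triangle y x c; last by apply/seteqP; split; exact: h.
move=> u [r [s [t [hr hs ht e ->]]]]; exists s, r, t; split=> //.
  by rewrite [s + r]addrC.
by rewrite [s *: _ + _]addrC.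
Qed.

Lemma segment_end f a b u : linear3 f -> f a < f b ->
  segment a b u -> f b <= f u -> u = b.
Proof.
move=> lf h [t ht ->]; rewrite lf => hu.
have t1 : t = 1 by nra.
by rewrite t1 subrr scale0r add0r scale1r.
Qed.

Lemma segment_le f k a b u : linear3 f -> f a <= k -> f b <= k ->
  segment a b u -> f u <= k.
Proof. by move=> lf ha hb [t ht ->]; rewrite lf; nra. Qed.

Lemma aff_indep a b c :
  (forall s t : R, s * (cx b - cx a) + t * (cx c - cx a) = 0 ->
     s * (cy b - cy a) + t * (cy c - cy a) = 0 ->
     s * (cz b - cz a) + t * (cz c - cz a) = 0 -> s = 0 /\ t = 0) ->
  affinely_independent a b c.
Proof.
move=> h s t e.
have e' f : linear3 f -> f 0 = 0 -> s * (f b - f a) + t * (f c - f a) = 0.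
  move=> lf f0; rewrite -[RHS]f0 -e lf.
  by rewrite -[b - a]scale1r -[c - a]scale1r !scalerBr -!scaleNr !lf; ring.
by apply: h; apply: e'; (exact: lin_cx || exact: lin_cy || exact: lin_cz || rewrite /cx /cy /cz mxE).
Qed.

Lemma iso_eq K K' : K = K' -> isotopic K K'.
Proof. by move=> ->; exact: rst_refl. Qed.
Lemma iso_sym K K' : isotopic K K' -> isotopic K' K.
Proof. exact: rst_sym. Qed.
Lemma iso_trans K2 K1 K3 : isotopic K1 K2 -> isotopic K2 K3 -> isotopic K1 K3.
Proof. exact: rst_trans. Qed.

Lemma iso_delta K K' L a b c :
  K = L `|` segment a b -> K' = L `|` (segment a c `|` segment c b) ->
  affinely_independent a b c ->
  (forall u, L u -> triangle a b c u -> u = a \/ u = b) ->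
  isotopic K K'.
Proof.
move=> -> -> hi hL; apply: rst_step; exists L, a, b, c; split=> //.
- by rewrite polyline1.
- by rewrite polyline2.
- by move=> u [/hL h /h[] ->]; [left|right].
Qed.

End Coordinates.

(* Equality of two unions of the same sets. *)
Ltac set_ac := apply/seteqP; split=> ?; rewrite /setU /mkset /=; tauto.

(** * Lifting a monotone strand *)

Section Lift.
Context {R : realType}.
Implicit Types (u v a b c : 'rV[R]_3) (L K : set 'rV[R]_3).

(** A vertex [c] of a polygon that is monotone in the second coordinate can be
    removed even when [a], [c], [b] are collinear, where the Delta-move
    degenerates: the two polygons are then the same set. *)
Lemma iso_flat K K' L a b c :
  K = L `|` (segment a c `|` segment c b) -> K' = L `|` segment a b ->
  cy a < cy c < cy b ->
  (forall u, L u -> triangle a b c u -> u = a \/ u = b) ->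
  isotopic K K'.
Proof.
move=> -> -> /andP[hac hcb] hL.
have [hi|] := pselect (affinely_independent a b c).
  by apply: iso_sym; apply: iso_delta hi hL.
move=> hn; apply: iso_eq; congr (_ `|` _); symmetry.
apply: segment_split; apply: contrapT => hseg; apply: hn => s t e.
have hy : s * (cy b - cy a) + t * (cy c - cy a) = 0.
  have := congr1 cy e; rewrite lin_cy -[b - a]scale1r -[c - a]scale1r !scalerBr.
  by rewrite -!scaleNr !lin_cy => h; rewrite [in RHS]/cy mxE in h; rewrite -h; ring.
have [t0|t0] := eqVneq t 0.
  split=> //; move: hy; rewrite t0 mul0r addr0 => /eqP; rewrite mulf_eq0 => /orP[/eqP//|/eqP].
  lra.
case: hseg; exists (- s / t).
  have hs : - s = t * ((cy c - cy a) / (cy b - cy a)).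
    have hB : cy b - cy a != 0 by rewrite gt_eqF //; lra.
    by apply: (mulIf hB); rewrite -mulrA divfK //; lra.
  rewrite hs mulrAC divff // mul1r; apply/andP; split.
    by rewrite divr_ge0; lra.
  by rewrite ler_pdivrMr; lra.
have -> : c = a + t^-1 *: (t *: (c - a)) by rewrite scalerA mulVf // scale1r addrC subrK.
have -> : t *: (c - a) = - s *: (b - a) by apply/eqP; rewrite scaleNr -addr_eq0 addrC e.
rewrite scalerA mulrC scalerBr addrA addrAC -[X in X - _]scale1r -scalerBl.
by rewrite addrC addrC.
Qed.


(** In this form, it does not matter which of [a] and [h] is greater. *)
Definition between (z a h : R) := 0 <= (z - a) * (h - z).

Definition lift_to (h : R) v : 'rV[R]_3 := pt3 (cx v) (cy v) h.

(** The open polygon with vertices [V i], ..., [V n]; it is indexed from both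
    ends because lifting a strand consumes it from its start. *)
Definition chain (V : nat -> 'rV[R]_3) i n : set 'rV[R]_3 :=
  \bigcup_(k in [set k | (i <= k < n)%N]) segment (V k) (V k.+1).

Lemma lift_cx h v : cx (lift_to h v) = cx v. Proof. exact: cx_pt. Qed.
Lemma lift_cy h v : cy (lift_to h v) = cy v. Proof. exact: cy_pt. Qed.
Lemma lift_cz h v : cz (lift_to h v) = h. Proof. exact: cz_pt. Qed.
Definition lift_c := (lift_cx, lift_cy, lift_cz).

(** Both triangles into which the vertical rectangle over an edge [a b] is cut
    lie between that edge and the level [h]. This needs [a] and [b] to be on the
    same side of the level. *)
Lemma column_lower h a b u : 0 < (h - cz a) * (h - cz b) ->
  triangle (lift_to h a) b a u ->
  exists2 t : R, 0 <= t <= 1 & let w := (1 - t) *: a + t *: b in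
    [/\ cx u = cx w, cy u = cy w & between (cz u) (cz w) h].
Proof.
move=> hab /triangleP[r [s [t [[hr [hs ht]] e]]]]; rewrite !lift_c => ex ey ez.
exists s; first by apply/andP; split; lra.
have -> : 1 - s = r + t by lra.
split; rewrite ?(lin_cx,lin_cy,lin_cz) ?ex ?ey; try ring.
rewrite /between.
have -> : cz u - ((r + t) * cz a + s * cz b) = r * (h - cz a) by rewrite ez; ring.
have -> : h - cz u = s * (h - cz b) + t * (h - cz a).
  by rewrite ez (_ : r = 1 - s - t); [ring|lra].
rewrite mulrDr; apply: addr_ge0.
  by rewrite mulrACA; apply: mulr_ge0; [exact: mulr_ge0|exact: ltW].
by rewrite mulrACA; apply: mulr_ge0; [exact: mulr_ge0|rewrite -expr2; exact: sqr_ge0].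
Qed.

Lemma column_upper h a b u : 0 < (h - cz a) * (h - cz b) ->
  triangle (lift_to h a) b (lift_to h b) u ->
  exists2 t : R, 0 <= t <= 1 & let w := (1 - t) *: a + t *: b in
    [/\ cx u = cx w, cy u = cy w & between (cz u) (cz w) h].
Proof.
move=> hab /triangleP[r [s [t [[hr [hs ht]] e]]]]; rewrite !lift_c => ex ey ez.
exists (s + t); first by apply/andP; split; lra.
have -> : 1 - (s + t) = r by lra.
split; rewrite ?(lin_cx,lin_cy,lin_cz) ?ex ?ey; try ring.
rewrite /between.
have -> : cz u - (r * cz a + (s + t) * cz b) = r * (h - cz a) + t * (h - cz b).
  by rewrite ez; ring.
have -> : h - cz u = s * (h - cz b).
  by rewrite ez (_ : r = 1 - s - t); [ring|lra].
rewrite mulrDl; apply: addr_ge0.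
  by rewrite mulrACA; apply: mulr_ge0; [exact: mulr_ge0|exact: ltW].
by rewrite mulrACA; apply: mulr_ge0; [exact: mulr_ge0|rewrite -expr2; exact: sqr_ge0].
Qed.

(** A strand that is monotone in the second coordinate, with nothing ([L_column])
    vertically between it and the level [h] and nothing ([L_level]) at that level,
    can be replaced by the straight strand at level [h] between vertical posts at
    its two ends. A corner travels along the strand from its start: in the
    intermediate stages [done i] the part up to the vertex [V i] has been lifted
    and pulled straight, and the polygon descends to [V i] along a post. *)
Section LiftStrand.
Variables (n : nat) (V : nat -> 'rV[R]_3) (h : R) (L : set 'rV[R]_3).
Hypothesis n_gt0 : (0 < n)%N.
Hypothesis V_up : forall i, cy (V i) < cy (V i.+1).
Hypothesis V_right : forall i, (i <= n)%N -> 0 < cx (V i).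
Hypothesis V_side : forall i j, (i <= n)%N -> (j <= n)%N ->
  0 < (h - cz (V i)) * (h - cz (V j)).
Hypothesis L_column : forall i t u, (i < n)%N -> 0 <= t <= 1 -> L u ->
  let w := (1 - t) *: V i + t *: V i.+1 in
  cx u = cx w -> cy u = cy w -> between (cz u) (cz w) h -> u = V 0%N \/ u = V n.
Hypothesis L_level : forall u, L u -> cz u = h -> 0 < cx u ->
  cy (V 0%N) < cy u < cy (V n) -> False.

Local Notation W i := (lift_to h (V i)).

Let V_le i j : (i <= j)%N -> cy (V i) <= cy (V j).
Proof.
elim: j => [|j IH]; first by rewrite leqn0 => /eqP->.
rewrite leq_eqVlt => /orP[/eqP->//|]; rewrite ltnS => /IH hij.
exact: le_trans hij (ltW (V_up j)).
Qed.

Let V_lt i j : (i < j)%N -> cy (V i) < cy (V j).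
Proof. by move=> ij; exact: lt_le_trans (V_up i) (V_le ij). Qed.

Let V_inj i j : cy (V i) <= cy (V j) -> (i <= j)%N.
Proof. by rewrite leqNgt => hij; apply/negP => /V_lt; rewrite ltNge hij. Qed.

Let chainS i : (i < n)%N -> chain V i n = segment (V i) (V i.+1) `|` chain V i.+1 n.
Proof.
move=> hi; apply/seteqP; split=> u.
  case=> k /= /andP[ik kn] hu; move: ik; rewrite leq_eqVlt => /orP[/eqP->|ik]; first by left.
  by right; exists k => //=; rewrite ik.
case=> [hu|[k /= /andP[ik kn] hu]]; first by exists i => //=; rewrite leqnn.
by exists k => //=; rewrite kn ltnW.
Qed.

Let chain_ge i u : chain V i n u -> cy (V i) <= cy u.
Proof.
case=> k /= /andP[/V_le ik _] /(segment_lin lin_cy)[t ht ->].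
have := V_up k; nra.
Qed.

Let chain_low i u : chain V i n u -> cy u <= cy (V i) -> u = V i.
Proof.
case=> k /= /andP[ik _] hu hy.
have hku : cy (V k) <= cy u.
  by move: hu => /(segment_lin lin_cy)[t ht ->]; have := V_up k; nra.
have ki : (k <= i)%N by apply: V_inj; apply: le_trans hy.
have {ik ki} ek : k = i by apply/eqP; rewrite eqn_leq ki.
subst k; move: hu; rewrite segmentC => hu.
by apply: (segment_end (linN lin_cy)) hu _; rewrite ?ltrN2 ?lerN2.
Qed.

Let tri_le i c u : cy c <= cy (V i.+1) -> triangle (W i) (V i.+1) c u -> cy u <= cy (V i.+1).
Proof.
by move=> hc; apply: (triangle_le lin_cy) => //; rewrite lift_cy ltW.
Qed.

Let tri_ge i c u : cy (V i) <= cy c -> triangle (W i) (V i.+1) c u -> cy (V i) <= cy u.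
Proof.
move=> hc hu; rewrite -lerN2.
by apply: (triangle_le (linN lin_cy)) hu; rewrite ?lift_cy lerN2 // ltW.
Qed.

Let mid i := L `|` (segment (V 0%N) (W 0) `|` segment (W 0) (W i)
  `|` segment (W i) (V i.+1) `|` chain V i.+1 n).
Let done i := L `|` (segment (V 0%N) (W 0) `|` segment (W 0) (W i)
  `|` segment (W i) (V i) `|` chain V i n).

Let left_le i u : (segment (V 0%N) (W 0) `|` segment (W 0) (W i)) u -> cy u <= cy (V i).
Proof.
have h0 := V_le (leq0n i).
by case; apply: (segment_le lin_cy); rewrite ?lift_cy.
Qed.

Let start_mid : isotopic (L `|` chain V 0 n) (mid 0).
Proof.
apply: (@iso_delta _ _ _ (L `|` chain V 1 n) (V 0%N) (V 1%N) (W 0)).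
- by rewrite chainS //; set_ac.
- have -> : mid 0 = L `|` (segment (V 0%N) (W 0) `|` segment (W 0) (V 1%N) `|` chain V 1 n).
    rewrite /mid (segment_eq (erefl (W 0))) (setUidl (_ : [set W 0] `<=` _)) // => _ ->.
    exact: segment_r.
  by set_ac.
- apply: aff_indep; rewrite lift_c subrr => s t _.
  rewrite lift_c subrr mulr0 addr0 => /eqP; rewrite mulf_eq0 => /orP[/eqP->|/eqP]; last first.
    by have := V_up 0; lra.
  rewrite mul0r add0r lift_c => /eqP; rewrite mulf_eq0 => /orP[/eqP->//|/eqP h0].
  by have := V_side (leq0n n) (leq0n n); rewrite h0 mul0r ltxx.
move=> u hLu hu.
have ule : cy u <= cy (V 1%N).
  by move: hu; apply: (triangle_le lin_cy) => //; rewrite ?lift_cy ltW.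
case: hLu => [hL|hc]; last by right; apply: chain_low.
have [|t ht [ex ey ez]] := column_lower (V_side (leq0n n) n_gt0) (u := u).
  by rewrite triangleAC triangleC triangleAC.
case: (L_column n_gt0 ht hL ex ey ez) => [->|e]; first by left.
right; have : (n <= 1)%N by apply: V_inj; rewrite -e.
by rewrite e => hn; congr V; apply/eqP; rewrite eqn_leq hn n_gt0.
Qed.


Let tri_end i c u : cy c <= cy (V i.+1) -> triangle (W i) (V i.+1) c u ->
  chain V i.+1 n u -> u = V i.+1.
Proof. by move=> hc hu hch; apply: chain_low hch _; apply: tri_le hc hu. Qed.

Let done_mid i : (0 < i < n)%N -> isotopic (done i) (mid i).
Proof.
move=> /andP[i0 hi]; apply: iso_sym.
apply: (@iso_delta _ _ _ (L `|` (segment (V 0%N) (W 0) `|` segment (W 0) (W i)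
  `|` chain V i.+1 n)) (W i) (V i.+1) (V i)).
- by rewrite /mid; set_ac.
- by rewrite /done chainS //; set_ac.
- apply: aff_indep; rewrite !lift_c => s t _.
  rewrite subrr mulr0 addr0 => /eqP; rewrite mulf_eq0 => /orP[/eqP->|/eqP]; last first.
    by have := V_up i; lra.
  rewrite mul0r add0r => /eqP; rewrite mulf_eq0 => /orP[/eqP->//|/eqP h0].
  by have := V_side (ltnW hi) (ltnW hi); rewrite -[X in X * _]opprB h0 oppr0 mul0r ltxx.
move=> u hLu hu.
have uge := tri_ge (lexx _) hu.
have ule := tri_le (ltW (V_up i)) hu.
case: hLu => [hL|[hS|hc]]; last by right; apply: tri_end hu hc; exact: ltW.
  have [t ht [ex ey ez]] := column_lower (V_side (ltnW hi) hi) hu.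
  case: (L_column hi ht hL ex ey ez) => e; move: uge ule; rewrite e => uge ule.
    by have := V_lt i0; rewrite ltNge uge.
  by right; congr V; apply/eqP; rewrite eqn_leq hi V_inj.
case: hS => hS.
  have := V_lt i0; rewrite ltNge (le_trans uge) //.
  by apply: (segment_le lin_cy) hS; rewrite ?lift_cy.
by left; apply: (segment_end lin_cy) hS _; rewrite !lift_cy // V_lt.
Qed.

Let mid_done i : (i < n)%N -> isotopic (mid i) (done i.+1).
Proof.
move=> hi.
have V_lt_up := V_up i.
have hne j : (j <= n)%N -> cz (V j) <> h.
  by move=> jn e; have := V_side jn jn; rewrite e subrr mul0r ltxx.
apply: (@iso_trans _ (L `|` (segment (V 0%N) (W 0) `|` segment (W 0) (W i)
  `|` segment (W i) (W i.+1) `|` segment (W i.+1) (V i.+1) `|` chain V i.+1 n))).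
  apply: (@iso_delta _ _ _ (L `|` (segment (V 0%N) (W 0) `|` segment (W 0) (W i)
    `|` chain V i.+1 n)) (W i) (V i.+1) (W i.+1)).
  - by rewrite /mid; set_ac.
  - by set_ac.
  - apply: aff_indep; rewrite !lift_c => s t _.
    rewrite -mulrDl => /eqP; rewrite mulf_eq0 => /orP[/eqP st|/eqP]; last by lra.
    rewrite subrr mulr0 addr0 => /eqP; rewrite mulf_eq0 => /orP[/eqP s0|/eqP h0].
      by split=> //; lra.
    by case: (hne _ hi); lra.
  move=> u hLu hu.
  have uge : cy (V i) <= cy u by apply: tri_ge hu; rewrite lift_cy ltW.
  have ule : cy u <= cy (V i.+1) by apply: tri_le hu; rewrite lift_cy.
  have ulow : cy u <= cy (V i) -> u = W i.
    by move=> hy; apply: (triangle_vertex (linN lin_cy)) hu _; rewrite !lift_cy ?lerN2 ?ltrN2.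
  case: hLu => [hL|[hS|hc]]; first last.
  - by right; apply: chain_low hc _.
  - by left; apply: ulow; apply: left_le hS.
  have [t ht [ex ey ez]] := column_upper (V_side (ltnW hi) hi) hu.
  case: (L_column hi ht hL ex ey ez) => e.
    by left; apply: ulow; rewrite e; apply: V_le.
  by right; rewrite e; congr V; apply/eqP; rewrite eqn_leq hi V_inj // -e.
case: (posnP i) => [i0|i0].
  rewrite i0 in hi V_lt_up *; apply: iso_eq; rewrite /done.
  rewrite (segment_eq (erefl (W 0))) (setUidl (_ : [set W 0] `<=` _)).
    by set_ac.
  by move=> _ ->; exact: segment_r.
apply: (@iso_flat _ _ (L `|` (segment (V 0%N) (W 0) `|`
   segment (W i.+1) (V i.+1) `|` chain V i.+1 n)) (W 0) (W i.+1) (W i)).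
- by set_ac.
- by rewrite /done; set_ac.
- by rewrite !lift_cy V_lt // V_up.
move=> u hLu hu.
have Vi0 := V_lt i0.
have Vi1 : cy (V 0%N) < cy (V i.+1) := lt_trans Vi0 V_lt_up.
have ulow : cy u <= cy (V 0%N) -> u = W 0.
  by move=> hy; apply: (triangle_vertex (linN lin_cy)) hu _; rewrite !lift_cy ?lerN2 ?ltrN2.
have uhigh : cy (V i.+1) <= cy u -> u = W i.+1.
  rewrite triangleC in hu.
  by move=> hy; apply: (triangle_vertex lin_cy) hu _; rewrite !lift_cy.
case: hLu => [hL|[[hS|hS]|hc]].
- have [|ylow] := leP (cy u) (cy (V 0%N)); first by left; exact: ulow.
  have [|yhigh] := leP (cy (V i.+1)) (cy u); first by right; exact: uhigh.
  exfalso; apply: (L_level hL).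
  + apply: le_anti; rewrite (triangle_le lin_cz _ _ _ hu) ?lift_cz //=.
    by rewrite -lerN2 (triangle_le (linN lin_cz) _ _ _ hu) ?lift_cz.
  + rewrite -oppr_lt0.
    by apply: (triangle_lt (linN lin_cx)) hu; rewrite lift_cx oppr_lt0 V_right // ltnW.
  + by rewrite ylow (lt_le_trans yhigh) // V_le.
- left; apply: ulow; apply: (segment_le lin_cy) hS; by rewrite ?lift_cy.
- right; apply: uhigh; rewrite -lerN2.
  by apply: (segment_le (linN lin_cy)) hS; rewrite ?lift_cy.
- by right; apply: uhigh; apply: chain_ge hc.
Qed.

Lemma lift_strand : isotopic (L `|` chain V 0 n)
  (L `|` (segment (V 0%N) (W 0) `|` segment (W 0) (W n) `|` segment (W n) (V n))).
Proof.
have hiso i : (i < n)%N -> isotopic (L `|` chain V 0 n) (done i.+1).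
  elim: i => [|i IH] hi; first exact: iso_trans start_mid (mid_done _).
  apply: iso_trans (IH (ltnW hi)) _.
  by apply: iso_trans (done_mid _) (mid_done hi).
have := hiso n.-1; rewrite prednK // => /(_ (leqnn n)) /iso_trans; apply.
apply: iso_eq; rewrite /done; suff -> : chain V n n = set0 by rewrite setU0.
by apply/seteqP; split=> u // [k /= /andP[h1 h2]]; lia.
Qed.

End LiftStrand.
End Lift.

(** * Closed braids as unions of strands *)

Section Strands.
Context {R : realType}.
Implicit Types (u v : 'rV[R]_3) (L K : set 'rV[R]_3).

Definition swap_at (i x : nat) : nat :=
  if x == i then i.+1 else if x == i.+1 then i else x.

Definition valid (p m : nat) (idx : nat -> nat) :=
  forall k, (k < m)%N -> (0 < idx k)%N && (idx k < p)%N.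

Fixpoint pos (idx : nat -> nat) (s k : nat) : nat :=
  if k is k'.+1 then swap_at (idx k') (pos idx s k') else s.

Lemma swap_at_inj i : injective (swap_at i).
Proof. by move=> x y; rewrite /swap_at; repeat case: ifP; lia. Qed.

Lemma pos_inj idx k : injective (pos idx ^~ k).
Proof. by elim: k => [|k IH] s t //= /swap_at_inj/IH. Qed.

Lemma pos_range p m idx s k : valid p m idx -> (k <= m)%N ->
  (0 < s <= p)%N -> (0 < pos idx s k <= p)%N.
Proof.
move=> hv; elim: k => [|k IH] //= km hs; have := IH (ltnW km) hs; have := hv _ km.
by rewrite /swap_at; repeat case: ifP; lia.
Qed.

Lemma pos_surj p m idx j k : valid p m idx -> (k <= m)%N -> (0 < j <= p)%N ->
  exists2 s, (0 < s <= p)%N & pos idx s k = j.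
Proof.
move=> hv; elim: k j => [|k IH] j km hj; first by exists j.
have hi := hv _ km.
have hj' : (0 < swap_at (idx k) j <= p)%N.
  by rewrite /swap_at; repeat case: ifP; lia.
have [s hs e] := IH _ (ltnW km) hj'; exists s => //=; rewrite e.
by rewrite /swap_at; repeat case: ifP; lia.
Qed.

(** Only the strand moving to the right leaves the plane [z = 0] at a crossing. *)
Definition mid_height idx (sg : nat -> bool) s k : R :=
  if pos idx s k.+1 == (pos idx s k).+1 then (if sg k then 1 else -1) else 0.

(** Strand [s] bends at the integer levels and, in the crossings, at the levels
    halfway between; bending every strand at all half-integer levels makes the
    strands comparable vertex by vertex. *)
Definition vertex idx sg s i : 'rV[R]_3 :=
  let k := i./2 in
  if odd i then pt3 (((pos idx s k)%:R + (pos idx s k.+1)%:R) / 2) (i%:R / 2)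
                    (mid_height idx sg s k)
  else pt3 (pos idx s k)%:R (i%:R / 2) 0.

Definition strand idx sg m s : set 'rV[R]_3 := chain (vertex idx sg s) 0 m.*2.

Lemma vertex_cy idx sg s i : cy (vertex idx sg s i) = i%:R / 2.
Proof. by rewrite /vertex; case: ifP; rewrite !c_pt. Qed.

Lemma vertex_even idx sg s k : vertex idx sg s k.*2 = pt3 (pos idx s k)%:R k%:R 0.
Proof.
by rewrite /vertex odd_double doubleK -muln2 natrM mulfK // pnatr_eq0.
Qed.

Lemma vertex_odd idx sg s k : vertex idx sg s k.*2.+1 =
  pt3 (((pos idx s k)%:R + (pos idx s k.+1)%:R) / 2) (k%:R + 2^-1) (mid_height idx sg s k).
Proof.
rewrite /vertex oddS odd_double /= uphalf_double; congr pt3.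
by rewrite -natr1 -muln2 natrM mulrDl mulfK ?pnatr_eq0 // mul1r.
Qed.

Definition layer idx sg s k : set 'rV[R]_3 :=
  segment (vertex idx sg s k.*2) (vertex idx sg s k.*2.+1) `|`
  segment (vertex idx sg s k.*2.+1) (vertex idx sg s k.+1.*2).

Lemma strandE idx sg m s :
  strand idx sg m s = \bigcup_(k in [set k | (k < m)%N]) layer idx sg s k.
Proof.
apply/seteqP; split=> u.
  case=> i /= hi hu; exists i./2; first by rewrite /=; lia.
  by rewrite /layer doubleS; move: hu; rewrite -[in X in X -> _](odd_double_half i);
    case: (odd i); [right|left].
case=> k /= hk []; [exists k.*2|exists k.*2.+1]; rewrite -?doubleS //=; lia.
Qed.

Lemma layer_over idx sg s k : pos idx s k = idx k ->
  layer idx sg s k = polyline (pt3 (idx k)%:R k%:R 0)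
    [:: pt3 ((idx k)%:R + 2^-1) (k%:R + 2^-1) (if sg k then 1 else -1);
        pt3 (idx k).+1%:R k.+1%:R 0].
Proof.
move=> e; have e' : pos idx s k.+1 = (idx k).+1 by rewrite /= e /swap_at eqxx.
rewrite /layer !vertex_even vertex_odd polyline2 /mid_height e e' eqxx.
have -> : ((idx k)%:R + (idx k).+1%:R) / 2 = (idx k)%:R + 2^-1 :> R.
  by rewrite -natr1; field.
by [].
Qed.

Lemma layer_straight idx sg s k : pos idx s k <> idx k ->
  layer idx sg s k = segment (pt3 (pos idx s k)%:R k%:R 0)
    (pt3 (pos idx s k.+1)%:R k.+1%:R 0).
Proof.
move=> e; rewrite /layer !vertex_even vertex_odd /mid_height.
have /negbTE-> : pos idx s k.+1 != (pos idx s k).+1.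
  by rewrite /= /swap_at; repeat case: ifP; lia.
symmetry; apply: segment_split; apply/segmentP; exists 2^-1; rewrite !c_pt.
by split; [lra|field|rewrite -natr1; field|ring].
Qed.

Lemma layers_letters p m idx sg k : valid p m idx -> (k < m)%N ->
  \bigcup_(s in [set s | (0 < s <= p)%N]) layer idx sg s k
    = letter_strands R p k (idx k, sg k).
Proof.
move=> hv km; have hi := hv _ km; apply/seteqP; split=> u.
  case=> s /= hs.
  have hp := pos_range hv (ltnW km) hs.
  have [e|e] := eqVneq (pos idx s k) (idx k).
    by rewrite layer_over // => hu; left; left.
  rewrite layer_straight; last by apply/eqP.
  rewrite /= /swap_at (negbTE e); case: ifP => [/eqP e'|/eqP e'] hu.
    by left; right; rewrite polyline1 -e'.
  by right; exists (pos idx s k); rewrite ?polyline1 //=; split=> //; split=> //; apply/eqP.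
case=> [[hu|hu]|[j /= [hj [j1 j2]] hu]].
- have [s hs e] := pos_surj hv (ltnW km) (j := idx k) ltac:(lia).
  by exists s => //; rewrite layer_over.
- have [s hs e] := pos_surj hv (ltnW km) (j := (idx k).+1) ltac:(lia).
  exists s => //; rewrite layer_straight e; last by lia.
  rewrite /= e /swap_at eqxx; case: ifP; first by lia.
  by rewrite -polyline1.
- have [s hs e] := pos_surj hv (ltnW km) hj.
  exists s => //; rewrite layer_straight e //.
  rewrite /= e /swap_at; case: ifP => [/eqP//|_]; case: ifP => [/eqP//|_].
  by rewrite -polyline1.
Qed.

Definition word_of idx sg m : braid_word := [seq (idx k, sg k) | k <- iota 0 m].

Lemma size_word_of idx sg m : size (word_of idx sg m) = m.
Proof. by rewrite size_map size_iota. Qed.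

Lemma nth_word_of idx sg m k x : (k < m)%N -> nth x (word_of idx sg m) k = (idx k, sg k).
Proof. by move=> km; rewrite (nth_map 0%N) ?size_iota // nth_iota // add0n. Qed.

(** The letters cut the closed braid horizontally, the strands vertically. *)
Lemma closure_strands p m idx sg : valid p m idx ->
  braid_closure R p (word_of idx sg m) =
  \bigcup_(s in [set s | (0 < s <= p)%N]) (strand idx sg m s `|` closing_arc R m s).
Proof.
move=> hv; rewrite /braid_closure size_word_of bigcupU; congr (_ `|` _).
apply/seteqP; split=> u.
  case=> k /= km; rewrite nth_word_of // -(layers_letters sg hv km) => -[s hs hu].
  by exists s => //; rewrite strandE; exists k.
case=> s /= hs; rewrite strandE => -[k /= km hu].
exists k => //=; rewrite nth_word_of //.
by rewrite -(layers_letters sg hv km); exists s.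
Qed.

End Strands.

(** * Layered braids *)

Section Layered.
Context {R : realType}.
Implicit Types (u v : 'rV[R]_3) (L K : set 'rV[R]_3).

Definition layered p m idx (sg : nat -> bool) (ht : nat -> R) :=
  forall k s t, (k < m)%N -> (0 < s <= p)%N -> (0 < t <= p)%N ->
    pos idx s k = idx k -> pos idx t k = (idx k).+1 -> sg k = (ht t < ht s).

Lemma pos_step idx sg s k (i := (idx k)%:R : R) (a := (pos idx s k)%:R : R)
    (a' := (pos idx s k.+1)%:R : R) (z := mid_height idx sg s k : R) :
  [\/ [/\ pos idx s k = idx k, a = i, a' = i + 1 & z = if sg k then 1 else -1],
      [/\ pos idx s k = (idx k).+1, a = i + 1, a' = i & z = 0],
      [/\ (pos idx s k < idx k)%N, a + 1 <= i, a' = a & z = 0] |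
      [/\ ((idx k).+1 < pos idx s k)%N, i + 2 <= a, a' = a & z = 0]].
Proof.
rewrite /a' /z /mid_height /= /swap_at /a.
have [e|ne] := eqVneq (pos idx s k) (idx k).
  by constructor 1; rewrite e eqxx natr1.
have [e|ne'] := eqVneq (pos idx s k) (idx k).+1.
  constructor 2; rewrite e -natr1; split=> //.
  by case: eqVneq => //; lia.
have -> : (pos idx s k == (pos idx s k).+1) = false by apply/eqP; lia.
case: (ltnP (pos idx s k) (idx k)) => h.
  by constructor 3; rewrite natr1 ler_nat.
have h' : ((idx k).+1 < pos idx s k)%N by lia.
by constructor 4; split=> //; rewrite /i -natrD ler_nat addn2.
Qed.

(** The difference of the first coordinates of two strands is affine on a half
    layer, and between two different integer positions it vanishes only at the
    centre of a crossing of the two. *)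
Lemma strands_cross p m idx sg (ht : nat -> R) s t i (x : R) :
  layered p m idx sg ht -> (0 < s <= p)%N -> (0 < t <= p)%N -> s <> t ->
  (i < m.*2)%N -> 0 <= x <= 1 ->
  let w j := (1 - x) *: vertex idx sg j i + x *: vertex idx sg j i.+1 in
  cx (w s) = cx (w t) -> ht t < ht s -> cz (w t) < cz (w s).
Proof.
move=> hl hs ht' st hi /andP[hx0 hx1] /=.
have hne k : pos idx s k <> pos idx t k by move/pos_inj.
have hk : (i./2 < m)%N by lia.
have h1 := hl _ _ _ hk hs ht'; have h2 := hl _ _ _ hk ht' hs.
rewrite !lin_cx !lin_cz.
move: (odd_double_half i) h1 h2; move: (i./2) => k <- h1 h2.
case: (odd i) => /=; rewrite ?add0n ?add1n -?doubleS !vertex_even !vertex_odd !c_pt;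
  case: (pos_step idx sg s k) => [[ps -> -> ->]|[ps -> -> ->]|[ps ls -> ->]|[ps ls -> ->]];
  case: (pos_step idx sg t k) => [[pt -> -> ->]|[pt -> -> ->]|[pt lt -> ->]|[pt lt -> ->]];
  move=> hxx hh; have {hne}ne : (pos idx s k)%:R != (pos idx t k)%:R :> R
    by rewrite eqr_nat; apply/eqP.
all: try by case/eqP: ne; rewrite ps pt.
all: try rewrite (h1 ps pt) hh; try rewrite (h2 pt ps) (lt_gtF hh).
all: clear h1 h2 hl hk hi hs ht' st ps pt hh.
all: try lra.
all: by case/eqP: ne; lra.
Qed.

End Layered.

(** * Flattening a layered braid *)

Section Flatten.
Context {R : realType}.
Implicit Types (u v : 'rV[R]_3) (L K : set 'rV[R]_3).

(** A strand from position [s] to position [q] straightened at height [h]: it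
    leaves and reaches the plane of the closing arcs along vertical posts. *)
Definition flat_strand (m s q : nat) (h : R) : set 'rV[R]_3 :=
  segment (pt3 s%:R 0 0) (pt3 s%:R 0 h) `|` segment (pt3 s%:R 0 h) (pt3 q%:R m%:R h)
  `|` segment (pt3 q%:R m%:R h) (pt3 q%:R m%:R 0).

Lemma arcE m j : closing_arc R m j =
  segment (pt3 j%:R m%:R 0) (pt3 j%:R (m%:R + j%:R) 0) `|`
  (segment (pt3 j%:R (m%:R + j%:R) 0) (pt3 (- j%:R) (m%:R + j%:R) 0) `|`
  (segment (pt3 (- j%:R) (m%:R + j%:R) 0) (pt3 (- j%:R) (- j%:R) 0) `|`
  (segment (pt3 (- j%:R) (- j%:R) 0) (pt3 j%:R (- j%:R) 0) `|`
   segment (pt3 j%:R (- j%:R) 0) (pt3 j%:R 0 0)))).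
Proof. by rewrite -(polyline1 (pt3 j%:R (- j%:R) 0)). Qed.

Lemma arc_shape m j u : closing_arc R m j u -> cz u = 0 /\
  [\/ cx u = j%:R /\ (m%:R <= cy u \/ cy u <= 0), cx u = - j%:R,
      cy u = m%:R + j%:R | cy u = - j%:R].
Proof.
have j0 : 0 <= j%:R :> R by [].
rewrite arcE => -[|[|[|[|]]]] /segmentP[t]; rewrite !c_pt => -[/andP[t0 t1] ex ey ez];
  (split; first by rewrite ez; ring).
- by constructor 1; split; [rewrite ex; ring|left; nra].
- by constructor 3; rewrite ey; ring.
- by constructor 2; rewrite ex; ring.
- by constructor 4; rewrite ey; ring.
- by constructor 1; split; [rewrite ex; ring|right; nra].
Qed.

(** Over the slab occupied by the braid, a closing arc shows only its ends, apart
    from its part on the other side of the axis. *)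
Lemma arc_slab m j u : (0 < j)%N -> closing_arc R m j u -> 0 < cx u -> 0 <= cy u <= m%:R ->
  u = pt3 j%:R 0 0 \/ u = pt3 j%:R m%:R 0.
Proof.
move=> j0; have {}j0 : 0 < j%:R :> R by rewrite ltr0n.
move=> /arc_shape[ez [[ex [hy|hy]]|ex|ey|ey]] hx /andP[y0 y1]; try (exfalso; lra).
  by right; apply: pt_ext; rewrite c_pt //; lra.
by left; apply: pt_ext; rewrite c_pt //; lra.
Qed.

Lemma flatP m s q h u : flat_strand m s q h u -> exists2 x : R, 0 <= x <= 1 &
  [\/ [/\ cx u = s%:R, cy u = 0 & cz u = x * h],
      [/\ cx u = q%:R, cy u = m%:R & cz u = x * h] |
      [/\ cx u = (1 - x) * s%:R + x * q%:R, cy u = x * m%:R & cz u = h]].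
Proof.
case=> [[|]|] /segmentP[x]; rewrite !c_pt => -[hx ex ey ez].
- exists x => //; constructor 1; rewrite ex ey ez; split; ring.
- exists x => //; constructor 3; rewrite ex ey ez; split; ring.
- exists (1 - x); first by lra.
  by constructor 2; rewrite ex ey ez; split; ring.
Qed.

Lemma flat_slab m s q h u : flat_strand m s q h u ->
  [\/ cy u = 0 /\ cx u = s%:R, cy u = m%:R /\ cx u = q%:R | cz u = h].
Proof.
by case/flatP=> x _ [[? ? _]|[? ? _]|[_ _ ?]]; [constructor 1|constructor 2|constructor 3].
Qed.

Lemma mid_height_bound idx sg s k : -1 <= (mid_height idx sg s k : R) <= 1.
Proof. by rewrite /mid_height; case: ifP => _; [case: ifP => _|]; lra. Qed.

Lemma vertex_bound idx sg s i : -1 <= cz (vertex idx sg s i : 'rV[R]_3) <= 1.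
Proof.
rewrite /vertex; case: ifP => _; rewrite c_pt; first exact: mid_height_bound.
lra.
Qed.

Lemma chain_bound (V : nat -> 'rV[R]_3) n u : (forall i, -1 <= cz (V i) <= 1) ->
  chain V 0 n u -> -1 <= cz u <= 1.
Proof.
move=> hV [i _ /segmentP[t [/andP[t0 t1] _ _ ->]]].
by have := hV i; have := hV i.+1; move=> /andP[? ?] /andP[? ?]; apply/andP; split; nra.
Qed.

(** A point of a strand is determined by its second coordinate, in a way that
    does not depend on the strand: points of two strands with equal second
    coordinates have the same parameters. *)
Lemma strand_param idx sg m s i (x : R) u : (i < m.*2)%N -> 0 <= x <= 1 ->
  strand idx sg m s u -> cy u = (i%:R + x) / 2 ->
  u = (1 - x) *: vertex idx sg s i + x *: vertex idx sg s i.+1.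
Proof.
move=> hi /andP[x0 x1] [j /= hj [y /andP[y0 y1] ->]].
rewrite lin_cy !vertex_cy -(natr1 j) => e.
have {}e : j%:R + y = i%:R + x by lra.
have [ji|ij|ij] := ltngtP j i.
- have : j.+1%:R <= i%:R :> R by rewrite ler_nat.
  rewrite -natr1 => hji.
  have [y1' x0'] : y = 1 /\ x = 0 by split; lra.
  have -> : i = j.+1 by apply/eqP; rewrite -(eqr_nat R) -natr1; apply/eqP; lra.
  by rewrite y1' x0' subrr subr0 !scale1r !scale0r addr0 add0r.
- have : i.+1%:R <= j%:R :> R by rewrite ler_nat.
  rewrite -natr1 => hji.
  have [y1' x0'] : x = 1 /\ y = 0 by split; lra.
  have -> : j = i.+1 by apply/eqP; rewrite -(eqr_nat R) -natr1; apply/eqP; lra.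
  by rewrite y1' x0' subrr subr0 !scale1r !scale0r addr0 add0r.
- by rewrite ij in e *; have -> : y = x by lra.
Qed.

Section OneStrand.
Variables (p m : nat) (idx : nat -> nat) (sg : nat -> bool) (ht : nat -> R).
Hypothesis m_gt0 : (0 < m)%N.
Hypothesis idxP : valid p m idx.
Hypothesis sgP : layered p m idx sg ht.
Hypothesis ht1 : forall s, (0 < s <= p)%N -> 1 < `|ht s|.

Let old s := strand idx sg m s `|` closing_arc R m s.
Let new s := flat_strand m s (pos idx s m) (ht s) `|` closing_arc R m s.
Let over (l : seq nat) (F : nat -> set 'rV[R]_3) := \bigcup_(s in [set s | s \in l]) F s.

(** The strand [s] can be flattened when the strands [l1] farther away from the
    plane have been flattened and the remaining ones [l2] belong closer to it. On
    the way to its height [ht s] it meets neither group: no strand of [l2] lies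
    on that side of it, and the strands of [l1] are beyond that height. *)
Lemma flatten_one (l1 l2 : seq nat) s :
  {in l1, forall t, (0 < t <= p)%N} -> {in l2, forall t, (0 < t <= p)%N} -> (0 < s <= p)%N ->
  {in l1, forall t, `|ht s| < `|ht t|} -> {in l2, forall t, `|ht t| < `|ht s|} ->
  isotopic (over l1 new `|` over l2 old `|` old s) (over l1 new `|` over l2 old `|` new s).
Proof.
move=> r1 r2 rs h1 h2.
set L := over l1 new `|` over l2 old `|` closing_arc R m s.
have V0 : vertex idx sg s 0 = pt3 s%:R 0 0 :> 'rV[R]_3 by rewrite (vertex_even _ _ _ 0).
have Vm := vertex_even (R := R) idx sg s m.
have hs1 := ht1 rs.
have Lcase u : L u -> [\/ exists2 t, t \in l1 & flat_strand m t (pos idx t m) (ht t) u,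
    exists2 t, t \in l2 & strand idx sg m t u |
    exists2 t, (0 < t <= p)%N & closing_arc R m t u].
  case=> [[[t /= tl [hu|hu]]|[t /= tl [hu|hu]]]|hu].
  - by constructor 1; exists t.
  - by constructor 3; exists t => //; apply: r1.
  - by constructor 2; exists t.
  - by constructor 3; exists t => //; apply: r2.
  - by constructor 3; exists s.
have Vx i : (i <= m.*2)%N -> 0 < cx (vertex idx sg s i : 'rV[R]_3).
  rewrite -[i in vertex _ _ _ i](odd_double_half i) => hi.
  case: (boolP (odd i)) => /= oi; rewrite ?add0n ?add1n ?vertex_even ?vertex_odd c_pt.
    have a := pos_range idxP (k := i./2) ltac:(lia) rs.
    have b := pos_range idxP (k := i./2.+1) ltac:(lia) rs.
    by rewrite divr_gt0 // -natrD ltr0n; lia.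
  by have a := pos_range idxP (k := i./2) ltac:(lia) rs; rewrite ltr0n; lia.
have hsign : 1 < ht s \/ ht s < -1 by move: hs1; rewrite lter_normr => /orP[]; [left|right]; lra.
have wz i (x : R) : 0 <= x <= 1 ->
    let w := (1 - x) *: vertex idx sg s i + x *: vertex idx sg s i.+1 in -1 <= cz w <= 1.
  move=> /andP[x0 x1] /=; rewrite lin_cz.
  have /andP[? ?] := vertex_bound idx sg s i; have /andP[? ?] := vertex_bound idx sg s i.+1.
  by apply/andP; split; nra.
have key : isotopic (L `|` strand idx sg m s) (L `|` flat_strand m s (pos idx s m) (ht s)).
  rewrite /flat_strand -V0 -Vm.
  have e0 : pt3 s%:R 0 (ht s) = lift_to (ht s) (vertex idx sg s 0) by rewrite V0 /lift_to !c_pt.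
  have em : pt3 (pos idx s m)%:R m%:R (ht s) = lift_to (ht s) (vertex idx sg s m.*2).
    by rewrite Vm /lift_to !c_pt.
  rewrite e0 em; apply: lift_strand.
  - by rewrite double_gt0.
  - by move=> i; rewrite !vertex_cy -(natr1 i); lra.
  - exact: Vx.
  - move=> i j _ _.
    have /andP[? ?] := vertex_bound idx sg s i.
    have /andP[? ?] := vertex_bound idx sg s j.
    by case: hsign => ?; [apply: mulr_gt0|rewrite nmulr_rgt0]; lra.
  - move=> i x u hi hx hL /= ex ey hb.
    have /andP[wz0 wz1] := wz i _ hx; have /andP[x0 x1] := hx.
    have eyy : cy u = (i%:R + x) / 2 by rewrite ey lin_cy !vertex_cy -(natr1 i); field.
    have i0 : 0 <= i%:R :> R by [].
    have im : i%:R + 1 <= 2 * m%:R :> R by rewrite natr1 -natrM ler_nat mul2n.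
    have bot : cy u = 0 -> cx u = s%:R.
      move=> yu; have [iz xz] : i%:R = 0 :> R /\ x = 0 by split; lra.
      move/eqP: iz; rewrite pnatr_eq0 => /eqP iz.
      by rewrite ex iz xz lin_cx subr0 mul1r mul0r addr0 V0 c_pt.
    have top : cy u = m%:R -> cx u = (pos idx s m)%:R.
      move=> yu; have [iz xz] : i%:R + 1 = 2 * m%:R :> R /\ x = 1 by split; lra.
      have iz' : i.+1 = m.*2.
        by apply/eqP; rewrite -(eqr_nat R) -natr1 iz -mul2n natrM.
      by rewrite ex iz' xz lin_cx subrr mul0r mul1r add0r Vm c_pt.
    case: (Lcase _ hL) => -[t tl hu].
    + have ht12 := h1 _ tl; have rt := r1 _ tl.
      have tns : t <> s by move=> e; move: ht12; rewrite e ltxx.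
      case: (flat_slab hu) => [[/bot -> /eqP]|[/top -> /eqP]|zu].
      * by rewrite eqr_nat => /eqP e; case: tns.
      * by rewrite eqr_nat => /eqP/pos_inj e; case: tns.
      exfalso; move: hb; rewrite /between zu leNgt => /negP; apply.
      move: ht12; rewrite lter_normr => /orP[] ht12; move: (ht12); rewrite lter_norml => /andP[? ?].
        by rewrite pmulr_rlt0; case: hsign; lra.
      by rewrite nmulr_rlt0; case: hsign; lra.
    + have ht12 := h2 _ tl; have rt := r2 _ tl.
      have tns : t <> s by move=> e; move: ht12; rewrite e ltxx.
      have eu := strand_param hi hx hu eyy.
      move: ht12; rewrite lter_normr => ht12.
      exfalso; move: hb; rewrite /between leNgt => /negP; apply.
      have cr := strands_cross sgP.
      have uz := chain_bound (vertex_bound idx sg t) hu.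
      case: hsign => hs.
        have hts : ht t < ht s by move: ht12 => /orP[]; rewrite lter_norml; lra.
        rewrite pmulr_llt0 ?subr_lt0; last by lra.
        by rewrite eu; apply: (cr _ _ _ _ rs rt) => //; [exact: nesym|rewrite -ex {1}eu].
      have hts : ht s < ht t by move: ht12 => /orP[]; rewrite lter_norml; lra.
      rewrite nmulr_llt0 ?subr_gt0; last by lra.
      by rewrite eu; apply: (cr _ _ _ _ rt rs) => //; rewrite -ex -eu.
    + have ux : 0 < cx u.
        rewrite ex lin_cx; have := Vx i (ltnW hi); have := Vx i.+1 hi.
        by move=> a b; nra.
      have /andP[t0 _] := tl.
      have uy : 0 <= cy u <= m%:R by rewrite eyy; lra.
      case: (arc_slab t0 hu ux uy) => eu.
        left; rewrite V0 eu; congr pt3.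
        by rewrite -bot // eu c_pt.
      right; rewrite Vm eu; congr pt3.
      by rewrite -top // eu c_pt.
  - move=> u hL zu ux; rewrite !vertex_cy mul0r -muln2 natrM mulfK ?pnatr_eq0 // => /andP[y0 y1].
    case: (Lcase _ hL) => -[t tl hu].
    + case: (flat_slab hu) => [[yu _]|[yu _]|zu'].
      * by rewrite yu ltxx in y0.
      * by rewrite yu ltxx in y1.
      * by have := h1 _ tl; rewrite -zu -zu' ltxx.
    + have /andP[z0 z1] := chain_bound (vertex_bound idx sg t) hu.
      by case: hsign; rewrite -zu ltNge ?z0 ?z1.
    + case/andP: tl => t0 _; case: (arc_slab t0 hu ux) => [|eu|eu].
      * by rewrite !ltW.
      * by rewrite eu c_pt ltxx in y0.
      * by rewrite eu c_pt ltxx in y1.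
apply: iso_trans (iso_trans (iso_eq _) key) (iso_eq _); rewrite /L /old /new; set_ac.
Qed.

Hypothesis ht_inj : forall s t, (0 < s <= p)%N -> (0 < t <= p)%N ->
  `|ht s| = `|ht t| -> s = t.

(** The strands are flattened by decreasing distance of their heights from the
    plane. Heights of both signs occur, so this proceeds from the top and from the
    bottom of the braid at the same time. *)
Lemma flatten_strands :
  isotopic (\bigcup_(s in [set s | (0 < s <= p)%N]) old s)
           (\bigcup_(s in [set s | (0 < s <= p)%N]) new s).
Proof.
pose r s t := `|ht t| <= `|ht s|.
have main l2 l1 : uniq (l1 ++ l2) -> {in l1 ++ l2, forall t, (0 < t <= p)%N} ->
    pairwise r (l1 ++ l2) -> isotopic (over l1 new `|` over l2 old) (over (l1 ++ l2) new).
  elim: l2 l1 => [|s l2 IH] l1.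
    move=> _ _ _; apply: iso_eq; rewrite cats0 (_ : over [::] old = set0) ?setU0 //.
    by apply/seteqP; split=> u // [].
  move=> hu hr hp; rewrite -cat_rcons.
  apply: (@iso_trans _ (over l1 new `|` over l2 old `|` old s)).
    apply: iso_eq; apply/seteqP; split=> u.
      case; first by do 2 left.
      case=> t /=; rewrite inE => /orP[/eqP->|tl] h; first by right.
      by left; right; exists t.
    case=> [[h|[t /= tl h]]|h]; first by left.
      by right; exists t => //=; rewrite inE tl orbT.
    by right; exists s => //=; rewrite inE eqxx.
  move: (hu) (hp); rewrite cat_uniq pairwise_cat /= => /and3P[_ hn /andP[snl2 _]].
  rewrite allrel_consr => /and3P[/andP[hs1 _] _ /andP[hs2 _]].
  have snl1 : s \notin l1 by apply: contra hn => h; rewrite /= h.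
  have rs : (0 < s <= p)%N by apply: hr; rewrite mem_cat inE eqxx orbT.
  have r1 : {in l1, forall t, (0 < t <= p)%N} by move=> t h; apply: hr; rewrite mem_cat h.
  have r2 : {in l2, forall t, (0 < t <= p)%N}.
    by move=> t h; apply: hr; rewrite mem_cat inE h !orbT.
  apply: iso_trans (flatten_one r1 r2 rs _ _) _.
  - move=> t h; have hle : `|ht s| <= `|ht t| := allP hs1 _ h.
    rewrite lt_neqAle hle andbT; apply: contra snl1 => /eqP e.
    by rewrite (ht_inj rs (r1 _ h) e).
  - move=> t h; have hle : `|ht t| <= `|ht s| := allP hs2 _ h.
    rewrite lt_neqAle hle andbT; apply: contra snl2 => /eqP e.
    by rewrite -(ht_inj (r2 _ h) rs e).
  apply: iso_trans (IH (rcons l1 s) _ _ _); rewrite ?cat_rcons //.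
  apply: iso_eq; apply/seteqP; split=> u.
    case=> [[[t /= tl h]|h]|h]; [left|by right|left].
      by exists t => //=; rewrite mem_rcons inE tl orbT.
    by exists s => //=; rewrite mem_rcons inE eqxx.
  case=> [[t /=]|h]; last by left; right.
  rewrite mem_rcons inE => /orP[/eqP->|tl] h; first by right.
  by do 2 left; exists t.
pose l := sort r (iota 1 p).
have lP s : s \in l = (0 < s <= p)%N by rewrite mem_sort mem_iota add1n ltnS.
have overE F : over l F = \bigcup_(s in [set s | (0 < s <= p)%N]) F s.
  by congr bigcup; apply/seteqP; split=> s /=; rewrite lP.
rewrite -!overE; apply: iso_trans (main l [::] _ _ _).
- by apply: iso_eq; apply/seteqP; split=> u; [right|case=> // -[]].
- by rewrite sort_uniq iota_uniq.
- by move=> s; rewrite /= lP.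
rewrite /= -sorted_pairwise; first by apply: sort_sorted => s t; exact: le_total.
by move=> s t w /= h1 h2; apply: le_trans h2 h1.
Qed.

End OneStrand.
End Flatten.

(** * Crossing changes in a braid word *)

Section CrossingChanges.
Context {R : realType}.
Implicit Types (u v a b c : 'rV[R]_3).

Lemma proj_ext (x y : 'rV[R]_2) :
  x 0 (@Ordinal 2 0 isT) = y 0 (@Ordinal 2 0 isT) ->
  x 0 (@Ordinal 2 1 isT) = y 0 (@Ordinal 2 1 isT) -> x = y.
Proof.
move=> e0 e1; apply/rowP=> -[[|[|//]] hi]; rewrite (bool_irrelevance hi isT).
  exact: e0.
exact: e1.
Qed.

Lemma proj_x u : projxy u 0 (@Ordinal 2 0 isT) = cx u.
Proof. by rewrite mxE; congr (u 0 _); apply: val_inj. Qed.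
Lemma proj_y u : projxy u 0 (@Ordinal 2 1 isT) = cy u.
Proof. by rewrite mxE; congr (u 0 _); apply: val_inj. Qed.

Lemma proj_lin (r s : R) u v : projxy (r *: u + s *: v) = r *: projxy u + s *: projxy v.
Proof. by apply/rowP=> j; rewrite !mxE. Qed.

Lemma proj_indep a b c :
  (forall s t : R, s * (cx b - cx a) + t * (cx c - cx a) = 0 ->
     s * (cy b - cy a) + t * (cy c - cy a) = 0 -> s = 0 /\ t = 0) ->
  affinely_independent (projxy a) (projxy b) (projxy c).
Proof.
move=> h s t e; apply: h; rewrite -?proj_x -?proj_y.
  by have := congr1 (fun v : 'rV[R]_2 => v 0 (@Ordinal 2 0 isT)) e; rewrite !mxE.
by have := congr1 (fun v : 'rV[R]_2 => v 0 (@Ordinal 2 1 isT)) e; rewrite !mxE.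
Qed.

Lemma proj_segment a b u : segment (projxy a) (projxy b) (projxy u) ->
  exists2 t : R, 0 <= t <= 1 & cx u = (1 - t) * cx a + t * cx b /\
                               cy u = (1 - t) * cy a + t * cy b.
Proof.
by move=> [t ht e]; exists t => //; rewrite -!proj_x -!proj_y e !mxE.
Qed.

Lemma letter_slab p k l u : letter_strands R p k l u ->
  k%:R <= cy u <= k.+1%:R /\ (cy u = k%:R \/ cy u = k.+1%:R -> cz u = 0).
Proof.
rewrite /letter_strands polyline1 polyline2 -(natr1 k).
have straight (x y : R) : segment (pt3 x k%:R 0) (pt3 y (k%:R + 1) 0) u ->
    k%:R <= cy u <= k%:R + 1 /\ (cy u = k%:R \/ cy u = k%:R + 1 -> cz u = 0).
  move=> /segmentP[t]; rewrite !c_pt => -[/andP[t0 t1] _ ey ez].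
  by split=> [|_]; [rewrite ey; lra|rewrite ez; ring].
case=> [[[|]|]|[j _]]; last 2 first.
- exact: straight.
- by rewrite polyline1; exact: straight.
- move=> /segmentP[t]; rewrite !c_pt => -[/andP[t0 t1] _ ey ez].
  split=> [|hy]; first by rewrite ey; lra.
  have t00 : t = 0 by case: hy => hy; lra.
  by rewrite ez t00; ring.
- move=> /segmentP[t]; rewrite !c_pt => -[/andP[t0 t1] _ ey ez].
  split=> [|hy]; first by rewrite ey; lra.
  have t00 : t = 1 by case: hy => hy; lra.
  by rewrite ez t00; ring.
Qed.

(** Only the overpass or underpass of the [k]-th letter is moved. Its projection
    meets that of the rest of the closed braid at the crossing and, by
    [letter_slab] and [arc_slab], at most at its own ends. *)
Lemma change_letter p m idx (sg sg' : nat -> bool) k : valid p m idx -> (k < m)%N ->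
  sg' k = ~~ sg k -> (forall j, j <> k -> sg' j = sg j) ->
  crossing_change (braid_closure R p (word_of idx sg m))
                  (braid_closure R p (word_of idx sg' m)).
Proof.
move=> hv km ek eother.
set i := idx k; have hi := hv _ km.
pose pt (j h : nat) : 'rV[R]_3 := pt3 j%:R h%:R 0.
pose mid (s : bool) : 'rV[R]_3 := pt3 (i%:R + 2^-1) (k%:R + 2^-1) (if s then 1 else -1).
pose L := \bigcup_(j in [set j | (j < m)%N /\ j <> k]) letter_strands R p j (idx j, sg j)
  `|` (segment (pt i.+1 k) (pt i k.+1) `|`
  \bigcup_(j in [set j | (1 <= j <= p)%N /\ j <> i /\ j <> i.+1])
    polyline (pt j k) [:: pt j k.+1])
  `|` \bigcup_(j in [set j | (1 <= j <= p)%N]) closing_arc R m j.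
have closureE (s : nat -> bool) : (forall j, j <> k -> s j = sg j) ->
    braid_closure R p (word_of idx s m) = L `|` polyline (pt i k) [:: mid (s k); pt i.+1 k.+1].
  move=> hs; rewrite /braid_closure size_word_of /L.
  have -> : \bigcup_(k0 in [set k0 | (k0 < m)%N])
      letter_strands R p k0 (nth (0%N, true) (word_of idx s m) k0) =
      \bigcup_(j in [set j | (j < m)%N /\ j <> k]) letter_strands R p j (idx j, sg j)
      `|` letter_strands R p k (i, s k).
    apply/seteqP; split=> u.
      case=> j /= jm; rewrite nth_word_of //.
      have [->|/eqP jk] := eqVneq j k; first by right.
      by rewrite hs //; left; exists j.
    case=> [[j /= [jm jk]]|]; first by exists j => //; rewrite nth_word_of // hs.
    by exists k => //; rewrite nth_word_of.
  rewrite /letter_strands polyline1 -/(pt _ _) -/(mid _).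
  by set_ac.
have i1 : i.+1%:R = i%:R + 1 :> R by rewrite natr1.
have k1 : k.+1%:R = k%:R + 1 :> R by rewrite natr1.
have kR : 0 <= k%:R :> R by [].
have kmR : k%:R + 1 <= m%:R :> R by rewrite natr1 ler_nat.
exists L, (pt i k), (pt i.+1 k.+1), (mid (sg k)), (mid (sg' k)), (pt i.+1 k), (pt i k.+1),
  (pt3 (i%:R + 2^-1) (k%:R + 2^-1) 0).
split.
- by rewrite -!closureE.
- split; last by apply: proj_ext; rewrite ?proj_x ?proj_y !c_pt.
  exists 2^-1; first by lra.
  rewrite -proj_lin; apply: proj_ext; rewrite ?proj_x ?proj_y ?(lin_cx,lin_cy) !c_pt ?i1 ?k1.
    by field.
  by field.
- split.
  + rewrite ek => /(congr1 cz); rewrite !c_pt; case: (sg k) => /=; lra.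
  + exists 2^-1; first by lra.
    by apply: pt_ext; rewrite ?(lin_cx,lin_cy,lin_cz) !c_pt ?ek; case: (sg k) => /=; field.
  + exists 2^-1; first by lra.
    by apply: pt_ext; rewrite ?(lin_cx,lin_cy,lin_cz) !c_pt ?i1 ?k1; field.
  + by move=> u hu; left; right; left.
- by apply: proj_indep => s t; rewrite !c_pt i1 k1 => ex ey; split; lra.
move=> u hL /proj_segment[t /andP[t0 t1]]; rewrite !c_pt i1 k1 => -[ex ey].
have {}ex : cx u = i%:R + t by rewrite ex; ring.
have {}ey : cy u = k%:R + t by rewrite ey; ring.
have ends : cz u = 0 -> t = 0 \/ t = 1 -> [\/ u = pt i k, u = pt i.+1 k.+1 |
    u = pt3 (i%:R + 2^-1) (k%:R + 2^-1) 0].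
  move=> ez [e|e]; [constructor 1|constructor 2]; apply: pt_ext; rewrite !c_pt // ?ex ?ey e; lra.
case: hL => [[[j [jm jk] hu]|[hu|[j [hj [ji ji1]] hu]]]|[j hj hu]].
- have [hy hz] := letter_slab hu; move: hy; rewrite ey => /andP[y0 y1].
  case: (ltngtP j k) => // jk'.
    have : j.+1%:R <= k%:R :> R by rewrite ler_nat.
    move=> hjk; apply: ends; last by left; lra.
    by apply: hz; right; lra.
  have : k.+1%:R <= j%:R :> R by rewrite ler_nat.
  move=> hjk; apply: ends; last by right; lra.
  by apply: hz; left; lra.
- move: hu => /segmentP[x]; rewrite !c_pt ?i1 k1 => -[_ ex' ey' ez'].
  by constructor 3; apply: pt_ext; rewrite !c_pt; lra.
- move: hu; rewrite polyline1 => /segmentP[x]; rewrite !c_pt ?i1 k1 => -[_ ex' ey' ez'].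
  case: (ltngtP j i) => // hji.
    have : j.+1%:R <= i%:R :> R by rewrite ler_nat.
    by rewrite -natr1; lra.
  have : i.+2%:R <= j%:R :> R by rewrite ler_nat; lia.
  by rewrite -natr1 i1; lra.
- have hx : 0 < cx u by rewrite ex; have : 0 < i%:R :> R by [rewrite ltr0n; lia]; lra.
  case: (arc_slab _ hu hx) => [||eu|eu]; [by case/andP: hj|by rewrite ey; lra|..].
    have e := congr1 cy eu; rewrite ey c_pt in e.
    by apply: ends; [rewrite eu c_pt|left; lra].
  have e := congr1 cy eu; rewrite ey c_pt in e.
  by apply: ends; [rewrite eu c_pt|right; lra].
Qed.

End CrossingChanges.

(** * Closures of flat strands *)

Section Reductions.
Context {R : realType}.
Implicit Types (u v a b c : 'rV[R]_3) (L : set 'rV[R]_3).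

(** Affine independence can be tested on the images of three points under two
    functionals. The three lemmas below are the cases where the first functional
    takes the same value at two of the points, according to which one is left. *)
Lemma lin_indep (f g : 'rV[R]_3 -> R) a b c : linear3 f -> linear3 g ->
  (forall s t, s * (f b - f a) + t * (f c - f a) = 0 ->
     s * (g b - g a) + t * (g c - g a) = 0 -> s = 0 /\ t = 0) ->
  affinely_independent a b c.
Proof.
move=> lf lg h s t e.
have z (k : 'rV[R]_3 -> R) : linear3 k -> s * (k b - k a) + t * (k c - k a) = 0.
  move=> lk; have k0 : k 0 = 0 by have := lk 0 0 0 0; rewrite !scale0r addr0 !mul0r addr0.
  rewrite -[RHS]k0 -e lk -[b - a]scale1r -[c - a]scale1r !scalerBr -!scaleNr !lk; ring.
by apply: h; exact: z.
Qed.

Lemma indep_third (f g : 'rV[R]_3 -> R) a b c : linear3 f -> linear3 g ->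
  f c = f a -> f b <> f a -> g c <> g a -> affinely_independent a b c.
Proof.
move=> lf lg ec eb gc; apply: (lin_indep lf lg) => s t.
rewrite ec subrr mulr0 addr0 => /eqP; rewrite mulf_eq0 subr_eq0 => /orP[/eqP->|/eqP//].
rewrite mul0r add0r => /eqP; rewrite mulf_eq0 subr_eq0 => /orP[/eqP->|/eqP//].
by [].
Qed.

Lemma indep_second (f g : 'rV[R]_3 -> R) a b c : linear3 f -> linear3 g ->
  f b = f a -> f c <> f a -> g b <> g a -> affinely_independent a b c.
Proof.
move=> lf lg ec eb gc; apply: (lin_indep lf lg) => s t.
rewrite ec subrr mulr0 add0r => /eqP; rewrite mulf_eq0 subr_eq0 => /orP[/eqP->|/eqP//].
rewrite mul0r addr0 => /eqP; rewrite mulf_eq0 subr_eq0 => /orP[/eqP->|/eqP//].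
by [].
Qed.

Lemma indep_first (f g : 'rV[R]_3 -> R) a b c : linear3 f -> linear3 g ->
  f b = f c -> f c <> f a -> g b <> g c -> affinely_independent a b c.
Proof.
move=> lf lg ec eb gc; apply: (lin_indep lf lg) => s t.
rewrite ec -mulrDl => /eqP; rewrite mulf_eq0 subr_eq0 => /orP[/eqP st|/eqP//].
have -> : t = - s by lra.
rewrite (_ : _ + _ = s * (g b - g c)); last by ring.
move=> /eqP; rewrite mulf_eq0 subr_eq0 => /orP[/eqP->|/eqP//].
by rewrite oppr0.
Qed.

Local Notation state := (seq (nat * nat * R)).

(** [(s, q, h)] stands for the flat strand from [s] to [q] at height [h], taken
    together with the closing arc at its start, so that removing an entry from a
    list removes both. *)
Definition piece (m : nat) (x : nat * nat * R) : set 'rV[R]_3 :=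
  flat_strand m x.1.1 x.1.2 x.2 `|` closing_arc R m x.1.1.

Definition flat_closure (m : nat) (ss : state) : set 'rV[R]_3 :=
  \bigcup_(x in [set x | x \in ss]) piece m x.

Lemma flat_closure_cons m x ss : flat_closure m (x :: ss) = piece m x `|` flat_closure m ss.
Proof.
apply/seteqP; split=> u.
  case=> y /=; rewrite inE => /orP[/eqP->|hy] h; first by left.
  by right; exists y.
case=> [h|[y /= hy h]]; first by exists x => //=; rewrite inE eqxx.
by exists y => //=; rewrite inE hy orbT.
Qed.

Lemma flat_closure_eq m ss ss' : ss =i ss' -> flat_closure m ss = flat_closure m ss'.
Proof. by move=> h; congr bigcup; apply/seteqP; split=> x /=; rewrite h. Qed.

(** The vertical rectangle between a segment in the plane [z = 0] and the level
    [h] is crossed neither by strands at heights outside of it nor by strands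
    which do not cross the segment in the projection. Applied twice, through
    height 0, this moves a strand to any height. *)
Lemma raise_strand m s q (h : R) (ss : state) :
  (0 < m)%N -> (0 < s)%N -> (0 < q)%N -> h != 0 ->
  (forall x, x \in ss -> [/\ (0 < x.1.1)%N, x.1.1 <> s, x.1.2 <> q &
     [\/ x.2 * (h - x.2) < 0, (x.1.1 < s)%N /\ (x.1.2 < q)%N
       | (s < x.1.1)%N /\ (q < x.1.2)%N]]) ->
  isotopic (flat_closure m ((s, q, 0) :: ss)) (flat_closure m ((s, q, h) :: ss)).
Proof.
move=> m0 s0 q0 /eqP h0 hss.
have {}m0 : 0 < m%:R :> R by rewrite ltr0n.
have s0' : 0 < s%:R :> R by rewrite ltr0n.
have q0' : 0 < q%:R :> R by rewrite ltr0n.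
pose P0 : 'rV[R]_3 := pt3 s%:R 0 0; pose P1 : 'rV[R]_3 := pt3 q%:R m%:R 0.
pose A : 'rV[R]_3 := pt3 s%:R 0 h; pose B : 'rV[R]_3 := pt3 q%:R m%:R h.
set L := flat_closure m ss `|` closing_arc R m s.
have wall u : L u -> (exists2 x : R, 0 <= x <= 1 &
    [/\ cx u = (1 - x) * s%:R + x * q%:R, cy u = x * m%:R & 0 <= cz u * (h - cz u)]) ->
    u = P0 \/ u = P1.
  move=> hu [x hx [ex ey ez]].
  have [x0 x1] := andP hx.
  have bot : cy u = 0 -> cx u = s%:R.
    move=> e; have x00 : x = 0 by apply: (mulIf (lt0r_neq0 m0)); rewrite -ey e mul0r.
    by rewrite ex x00; ring.
  have top : cy u = m%:R -> cx u = q%:R.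
    move=> e; have x00 : x = 1 by apply: (mulIf (lt0r_neq0 m0)); rewrite -ey e mul1r.
    by rewrite ex x00; ring.
  have arc j : (0 < j)%N -> closing_arc R m j u -> u = P0 \/ u = P1.
    move=> j0 hj; case: (arc_slab j0 hj) => [||e|e].
    - rewrite ex; nra.
    - by rewrite ey; apply/andP; split; nra.
    - left; rewrite e; congr pt3; by rewrite -bot e c_pt.
    - right; rewrite e; congr pt3; by rewrite -top e c_pt.
  case: hu => [[[[a b] k] hy [hu|hu]]|]; last exact: arc.
    have [/= a0 as' bq hk] := hss _ hy.
    have [y hy' [[ex' /bot e _]|[ex' /top e _]|[ex' ey' ez']]] := flatP hu.
    - by case: as'; apply/eqP; rewrite -(eqr_nat R) -ex' e.
    - by case: bq; apply/eqP; rewrite -(eqr_nat R) -ex' e.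
    have exy : y = x by apply: (mulIf (lt0r_neq0 m0)); rewrite -ey -ey'.
    exfalso; case: hk => [|[h1 h2]|[h1 h2]].
    - by move: ez'; rewrite /= => <-; rewrite ltNge ez.
    - have : a.+1%:R <= s%:R :> R by rewrite ler_nat.
      have : b.+1%:R <= q%:R :> R by rewrite ler_nat.
      rewrite -(natr1 a) -(natr1 b) => hb ha.
      have : cx u < cx u by rewrite {1}ex' ex exy; nra.
      by rewrite ltxx.
    - have : s.+1%:R <= a%:R :> R by rewrite ler_nat.
      have : q.+1%:R <= b%:R :> R by rewrite ler_nat.
      rewrite -(natr1 s) -(natr1 q) => hb ha.
      have : cx u < cx u by rewrite {1}ex ex' exy; nra.
      by rewrite ltxx.
  by have [a0 _ _ _] := hss _ hy; exact: arc hu.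
have -> : flat_closure m ((s, q, 0) :: ss) = L `|` segment P0 P1.
  rewrite flat_closure_cons /piece /= /flat_strand /L !(segment_eq (erefl (pt3 _ _ _))) -/P0 -/P1.
  rewrite (setUidr (_ : [set P0] `<=` segment P0 P1)); last by move=> _ ->; exact: segment_l.
  rewrite (setUidl (_ : [set P1] `<=` segment P0 P1)); last by move=> _ ->; exact: segment_r.
  by set_ac.
have -> : flat_closure m ((s, q, h) :: ss) = L `|` (segment P0 A `|` segment A B `|` segment B P1).
  by rewrite flat_closure_cons /piece /= /flat_strand /L; set_ac.
apply: (@iso_trans _ (L `|` (segment P0 B `|` segment B P1))).
  apply: iso_delta => //.
    by apply: (indep_first lin_cy lin_cz); rewrite !c_pt; lra.
  move=> u hL /triangleP[x [y [z [[hx [hy hz]] e]]]]; rewrite !c_pt => ex ey ez.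
  apply: wall => //; exists (y + z); first by lra.
  split; [rewrite ex -e; ring|rewrite ey; ring|].
  rewrite ez -subr_ge0 (_ : _ - _ = z * (1 - z) * (h * h)); last by ring.
  by apply: mulr_ge0; [nra|rewrite -expr2; exact: sqr_ge0].
apply: (@iso_delta _ _ _ (L `|` segment B P1) P0 B A).
- by set_ac.
- by set_ac.
- by apply: (indep_third lin_cy lin_cz); rewrite !c_pt; lra.
move=> u hL hu.
have atB : m%:R <= cy u -> u = B.
  move=> hy; move: hu; rewrite triangleC => hu.
  by apply: (triangle_vertex lin_cy) hu _; rewrite !c_pt.
case: hL => [hL|/segmentP[x [_ _ ey _]]]; last first.
  by right; apply: atB; rewrite ey !c_pt; lra.
move: (hu) => /triangleP[x [y [z [[hx [hy hz]] e]]]]; rewrite !c_pt => ex ey ez.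
case: (wall _ hL) => [|->|eu]; [|by left|by right; apply: atB; rewrite eu c_pt].
exists y; first by lra.
split; [by rewrite ex (_ : x = 1 - y - z); [ring|lra]|rewrite ey; ring|].
rewrite ez (_ : _ * _ = (y + z) * (1 - (y + z)) * (h * h)); last by ring.
by apply: mulr_ge0; [nra|rewrite -expr2; exact: sqr_ge0].
Qed.

End Reductions.

(** * Removal of the innermost loop *)

(** The strand from [t] to [j], the innermost closing arc [j] and the strand from
    [j] to [q] together can be replaced by one strand from [t] to [q]. The loop
    they form is the polygon E A w1 c1 c2 c3 c4 w0 D F in the notation below; its
    vertices between E and F are removed one at a time. While the arc is being
    removed nothing is in the way, since all other strands and arcs are outside of
    the box bounded by the arc. The last triangles lie between the heights [g] and
    [k] of the two strands, and this is why no other strand may have a height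
    in between. A strand that starts between [j] and [t] must have a height of the
    other sign, so that the post at its start stays clear of these triangles. *)
Section Merge.
Context {R : realType}.
Implicit Types (u v a b c : 'rV[R]_3) (L : set 'rV[R]_3).

Variables (m t j q : nat) (g k : R) (ss : seq (nat * nat * R)).
Hypotheses (m_gt0 : (0 < m)%N) (j_gt0 : (0 < j)%N) (j_lt_t : (j < t)%N) (j_lt_q : (j < q)%N).
Hypotheses (gk : 0 < g * k) (g_neq_k : g != k).
Hypothesis ssP : forall x, x \in ss ->
  [/\ (j < x.1.1)%N /\ (j < x.1.2)%N, x.1.1 <> t, x.1.2 <> q,
      (x.2 - g) * (k - x.2) < 0 & (t < x.1.1)%N \/ x.2 * k < 0].

Local Notation pt := (@pt3 R).
Local Notation M := m%:R.
Local Notation J := j%:R.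
Let E := pt t%:R 0 g.
Let A := pt J M g.
Let D := pt J 0 k.
Let F := pt q%:R M k.
Let w1 := pt J M 0.
Let w0 := pt J 0 0.
Let c1 := pt J (M + J) 0.
Let c2 := pt (- J) (M + J) 0.
Let c3 := pt (- J) (- J) 0.
Let c4 := pt J (- J) 0.
Let foot := segment (pt t%:R 0 0) E.
Let others := flat_closure m ss `|` closing_arc R m t `|` segment F (pt q%:R M 0).

Let M0 : 0 < M :> R. Proof. by rewrite ltr0n. Qed.
Let J0 : 0 < J :> R. Proof. by rewrite ltr0n. Qed.
Let Jt : J < t%:R :> R. Proof. by rewrite ltr_nat. Qed.
Let Jq : J < q%:R :> R. Proof. by rewrite ltr_nat. Qed.
Let g0 : g != 0. Proof. by apply/eqP => e; move: gk; rewrite e mul0r ltxx. Qed.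
Let k0 : k != 0. Proof. by apply/eqP => e; move: gk; rewrite e mulr0 ltxx. Qed.

Ltac facts := have ? := M0; have ? := J0; have ? := Jt; have ? := Jq.

(** Between the heights [g] and [k], the rest of the knot shows only posts: at the
    starting level to the right of [t], at the final level to the right of [j]. *)
Let others_strip u : others u -> 0 <= cy u <= M -> 0 < cx u ->
  0 <= (cz u - g) * (k - cz u) -> (cy u = 0 /\ t%:R < cx u) \/ (cy u = M /\ J < cx u).
Proof.
facts.
move=> hu hy hx hz.
have zk : 0 < cz u * k.
  have [k1|k1|/eqP] := ltrgt0P k; last by rewrite (negbTE k0).
    have g1 : 0 < g by rewrite -(pmulr_lgt0 _ k1).
    rewrite pmulr_lgt0 // ltNge; apply/negP => z0; move: hz; apply/negP.
    by rewrite -ltNge nmulr_rlt0; lra.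
  have g1 : g < 0 by rewrite -(nmulr_lgt0 _ k1).
  rewrite nmulr_lgt0 // ltNge; apply/negP => z0; move: hz; apply/negP.
  by rewrite -ltNge pmulr_rlt0; lra.
have znz : cz u <> 0 by move=> e; move: zk; rewrite e mul0r ltxx.
have arc (a : nat) : (0 < a)%N -> closing_arc R m a u -> False.
  by move=> a0 /(arc_slab a0) []// e; apply: znz; rewrite e c_pt.
case: hu => [[[[[a b] h] /= hx' [hu|hu]]|hu]|].
- have [/= [ja jb] at' bq hk hs] := ssP hx'.
  have [y /andP[y0 y1] [[/= ex ey ez]|[/= ex ey ez]|[/= ex ey ez]]] := flatP hu.
  + left; split=> //; rewrite ex ltr_nat; case: hs => // hs.
    have : 0 < 0 :> R by apply: (lt_le_trans zk); rewrite ez -mulrA mulr_ge0_le0 // ltW.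
    by rewrite ltxx.
  + by right; split=> //; rewrite ex ltr_nat.
  + by move: hk; rewrite -ez ltNge hz.
- by have [/= [ja jb] _ _ _ _] := ssP hx'; case: (arc a (leq_ltn_trans (leq0n _) ja) hu).
- by case: (arc t (ltn_trans j_gt0 j_lt_t) hu).
- move=> /segmentP[y]; rewrite !c_pt => -[_ ex ey _]; right; split.
    by rewrite ey; ring.
  by rewrite ex (_ : _ + _ = q%:R) //; ring.
Qed.

Let others_box u : (others `|` foot) u -> cx u <= J -> ~ (- J <= cx u /\ - J <= cy u <= M + J).
Proof.
facts.
have nat_gt (a : nat) : (j < a)%N -> J + 1 <= a%:R :> R by rewrite natr1 ler_nat.
have arc (a : nat) : (j < a)%N -> closing_arc R m a u -> cx u <= J ->
    ~ (- J <= cx u /\ - J <= cy u <= M + J).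
  move=> /nat_gt ja /arc_shape[_ [[e _]|e|e|e]] hx [h1 /andP[h2 h3]].
  - by suff : cx u < cx u; [rewrite ltxx|lra].
  - by suff : cx u < cx u; [rewrite ltxx|lra].
  - by suff : cy u < cy u; [rewrite ltxx|lra].
  - by suff : cy u < cy u; [rewrite ltxx|lra].
case=> [[[[[[a b] h] /= hx' [hu|hu]]|hu]|]|]; first last.
- by move=> /segmentP[y]; rewrite !c_pt => -[_ ex _ _]; rewrite ex => h; exfalso; move: h; apply/negP; rewrite -ltNge; lra.
- by move=> /segmentP[y]; rewrite !c_pt => -[_ ex _ _]; rewrite ex => h; exfalso; move: h; apply/negP; rewrite -ltNge; lra.
- exact: arc hu.
- by have [/= [ja jb] _ _ _ _] := ssP hx'; exact: arc hu.
have [/= [/nat_gt ja /nat_gt jb] at' bq hk hs] := ssP hx'.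
have [y /andP[y0 y1] [[/= ex _ _]|[/= ex _ _]|[/= ex _ _]]] := flatP hu => hxx; exfalso.
- by suff : cx u < cx u; [rewrite ltxx|lra].
- by suff : cx u < cx u; [rewrite ltxx|lra].
- by suff : cx u < cx u; [rewrite ltxx|rewrite {2}ex; nra].
Qed.

Let base := others `|` foot `|` segment E A `|` segment D F.

Let base_box u : base u -> cx u <= J -> - J <= cx u /\ - J <= cy u <= M + J ->
  u = A \/ u = D.
Proof.
facts.
case=> [[hu|hu]|hu] hx hb; first by case: (others_box hu hx).
  left; apply: (segment_end (linN lin_cx)) hu _; rewrite !c_pt; lra.
rewrite segmentC in hu.
right; apply: (segment_end (linN lin_cx)) hu _; rewrite !c_pt; lra.
Qed.

Let base_flat u : base u -> cx u <= J -> - J <= cx u /\ - J <= cy u <= M + J -> cz u <> 0.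
Proof.
move=> hu hx hb; case: (base_box hu hx hb) => ->; rewrite c_pt; exact/eqP.
Qed.

Let postA u : segment A w1 u -> [/\ cx u = J, cy u = M & cz u = 0 -> u = w1].
Proof.
move=> /segmentP[x]; rewrite !c_pt => -[hx ex ey ez]; split; [rewrite ex; ring|rewrite ey; ring|].
move=> z0; have x1 : x = 1.
  move: ez; rewrite z0 mulr0 addr0 => /esym/eqP.
  by rewrite mulf_eq0 (negbTE g0) orbF subr_eq0 => /eqP.
by apply: pt_ext; rewrite ?c_pt ?ex ?ey ?z0 // x1; ring.
Qed.

Let postD u : segment w0 D u -> [/\ cx u = J, cy u = 0 & cz u = 0 -> u = w0].
Proof.
move=> /segmentP[x]; rewrite !c_pt => -[hx ex ey ez]; split; [rewrite ex; ring|rewrite ey; ring|].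
move=> z0; have x1 : x = 0.
  move: ez; rewrite z0 mulr0 add0r => /esym/eqP.
  by rewrite mulf_eq0 (negbTE k0) orbF => /eqP.
by apply: pt_ext; rewrite ?c_pt ?ex ?ey ?z0 // x1; ring.
Qed.

Let triangle_flat a b c u : cz a = 0 -> cz b = 0 -> cz c = 0 -> triangle a b c u -> cz u = 0.
Proof.
move=> a0 b0 c0 /triangleP[r [s [x [_ _ _ _ ->]]]]; rewrite a0 b0 c0; ring.
Qed.

Let box a := cx a <= J /\ - J <= cx a /\ - J <= cy a <= M + J.

Let triangle_box a b c u : box a -> box b -> box c -> triangle a b c u -> box u.
Proof.
move=> [a1 [a2 /andP[a3 a4]]] [b1 [b2 /andP[b3 b4]]] [d1 [d2 /andP[d3 d4]]] hu.
split; first exact: (triangle_le lin_cx) hu.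
split; first by rewrite -lerN2; apply: (triangle_le (linN lin_cx)) hu; rewrite lerN2.
apply/andP; split; last exact: (triangle_le lin_cy) hu.
by rewrite -lerN2; apply: (triangle_le (linN lin_cy)) hu; rewrite lerN2.
Qed.

Let box_flat a b c u : cz a = 0 -> cz b = 0 -> cz c = 0 ->
  box a -> box b -> box c -> triangle a b c u -> ~ base u.
Proof.
move=> a0 b0 c0 ba bb bc hu hb; have [h1 h2] := triangle_box ba bb bc hu.
by apply: (base_flat hb h1 h2); apply: triangle_flat hu.
Qed.

Ltac box := facts; rewrite /box !c_pt; repeat split; try (apply/andP; split); lra.

Lemma drop_lower_right :
  isotopic (base `|` segment A w1 `|` segment w0 D `|` closing_arc R m j)
    (base `|` segment A w1 `|` segment w0 D `|` segment w1 c1 `|` segment c1 c2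
       `|` segment c2 c3 `|` segment c3 w0).
Proof.
facts.
apply: iso_sym.
apply: (@iso_delta _ _ _ (base `|` segment A w1 `|` segment w0 D `|` segment w1 c1
  `|` segment c1 c2 `|` segment c2 c3) c3 w0 c4).
- by [].
- by rewrite arcE /w1 /c1 /c2 /c3 /c4 /w0; set_ac.
- by apply: (indep_third lin_cy lin_cx); rewrite !c_pt; lra.
move=> u hL hu.
have hz : cz u = 0 by apply: triangle_flat hu; rewrite c_pt.
have hy : cy u <= 0 by apply: (triangle_le lin_cy) hu; rewrite c_pt; lra.
case: hL => [[[[[hL|/postA[_ e _]]|/postD[_ _ /(_ hz)->]]|]|]|]; last 3 first.
- move=> /segmentP[x]; rewrite !c_pt => -[hx _ ey _].
  by exfalso; move: hy; apply/negP; rewrite -ltNge ey; nra.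
- move=> /segmentP[x]; rewrite !c_pt => -[hx _ ey _].
  by exfalso; move: hy; apply/negP; rewrite -ltNge ey; nra.
- move=> /segmentP[x]; rewrite !c_pt => -[hx ex _ _].
  left; apply: (triangle_vertex (linN lin_cx)) hu _; rewrite !c_pt ?ex; lra.
- by case: (box_flat _ _ _ _ _ _ hu hL); rewrite ?c_pt //; box.
- by exfalso; move: hy; apply/negP; rewrite -ltNge e.
- by right.
Qed.


Let B0 := base `|` segment A w1 `|` segment w0 D.

Let B0_flat a b c u : cz a = 0 -> cz b = 0 -> cz c = 0 ->
  box a -> box b -> box c -> triangle a b c u -> B0 u -> u = w1 \/ u = w0.
Proof.
move=> a0 b0 c0 ba bb bc hu; have hz := triangle_flat a0 b0 c0 hu.
case=> [[/(box_flat a0 b0 c0 ba bb bc hu)//|]|]; first by case/postA=> _ _ /(_ hz); left.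
by case/postD=> _ _ /(_ hz); right.
Qed.

Lemma drop_upper_right :
  isotopic (B0 `|` segment w1 c1 `|` segment c1 c2 `|` segment c2 c3 `|` segment c3 w0)
    (B0 `|` segment w1 c2 `|` segment c2 c3 `|` segment c3 w0).
Proof.
facts; apply: iso_sym.
apply: (@iso_delta _ _ _ (B0 `|` segment c2 c3 `|` segment c3 w0) w1 c2 c1).
- by set_ac.
- by set_ac.
- by apply: (indep_third lin_cx lin_cy); rewrite !c_pt; lra.
move=> u hL hu.
have hy : M <= cy u.
  by rewrite -lerN2; apply: (triangle_le (linN lin_cy)) hu; rewrite c_pt; lra.
case: hL => [[hL|]|].
- have [|e] : u = w1 \/ u = w0 by apply: B0_flat hu hL; rewrite ?c_pt //; box.
    by left.
  by exfalso; move: hy; apply/negP; rewrite -ltNge e c_pt.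
- move=> /segmentP[x]; rewrite !c_pt => -[hx ex _ _]; rewrite triangleC in hu.
  right; apply: (triangle_vertex (linN lin_cx)) hu _; rewrite !c_pt ?ex; lra.
- move=> /segmentP[x]; rewrite !c_pt => -[/andP[x0 x1] _ ey _].
  by exfalso; move: hy; apply/negP; rewrite -ltNge ey; nra.
Qed.

Lemma drop_upper_left :
  isotopic (B0 `|` segment w1 c2 `|` segment c2 c3 `|` segment c3 w0)
    (B0 `|` segment w1 c3 `|` segment c3 w0).
Proof.
facts; apply: iso_sym.
apply: (@iso_delta _ _ _ (B0 `|` segment c3 w0) w1 c3 c2).
- by set_ac.
- by set_ac.
- by apply: (indep_first lin_cx lin_cy); rewrite !c_pt; lra.
move=> u hL hu.
(* The line through w1 and c3 separates the triangle from the edge c3 w0 and the post D. *)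
pose f v := - (M + J) * cx v + 2 * J * cy v.
have lf : linear3 f by exact: lin_comb lin_cx lin_cy.
have fu : f c3 <= f u.
  rewrite -lerN2; apply: (triangle_le (linN lf)) hu; rewrite /f !c_pt; nra.
case: hL => [hL|hL].
  have [|e] : u = w1 \/ u = w0 by apply: B0_flat hu hL; rewrite ?c_pt //; box.
    by left.
  by exfalso; move: fu; apply/negP; rewrite -ltNge e /f !c_pt; nra.
rewrite segmentC in hL; right; apply: (segment_end lf _ hL fu).
by rewrite /f !c_pt; nra.
Qed.

Lemma drop_lower_left :
  isotopic (B0 `|` segment w1 c3 `|` segment c3 w0) (B0 `|` segment w1 w0).
Proof.
facts; apply: iso_sym; apply: (@iso_delta _ _ _ B0 w1 w0 c3).
- by [].
- by set_ac.
- by apply: (indep_second lin_cx lin_cy); rewrite !c_pt; lra.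
move=> u hL hu.
by apply: B0_flat hu hL; rewrite ?c_pt //; box.
Qed.

Lemma drop_post_end :
  isotopic (B0 `|` segment w1 w0) (base `|` segment w0 D `|` segment A w0).
Proof.
facts; apply: iso_sym; apply: (@iso_delta _ _ _ (base `|` segment w0 D) A w0 w1).
- by [].
- by rewrite /B0; set_ac.
- by apply: (indep_third lin_cy lin_cz); rewrite !c_pt; [|lra|exact/nesym/eqP].
move=> u hL hu; have [hx hb] := triangle_box (a := A) (b := w0) (c := w1) ltac:(box) ltac:(box) ltac:(box) hu.
have low : cy u <= 0 -> u = w0.
  move: hu; rewrite triangleC => hu hy.
  by apply: (triangle_vertex (linN lin_cy)) hu _; rewrite !c_pt; lra.
case: hL => [hL|/postD[_ e _]]; last by right; apply: low; rewrite e.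
case: (base_box hL hx hb) => e; first by left.
by right; apply: low; rewrite e c_pt.
Qed.

Lemma drop_post_start :
  isotopic (base `|` segment w0 D `|` segment A w0) (base `|` segment A D).
Proof.
facts; apply: iso_sym; apply: (@iso_delta _ _ _ base A D w0).
- by [].
- by set_ac.
- by apply: (indep_first lin_cy lin_cz); rewrite !c_pt; [|lra|exact/eqP].
move=> u hL hu.
have [hx hb] := triangle_box (a := A) (b := D) (c := w0) ltac:(box) ltac:(box) ltac:(box) hu.
exact: base_box.
Qed.


Let strip a := [/\ J <= cx a, 0 <= cy a <= M & cz a = g \/ cz a = k].

Let others_triangle a b c u : strip a -> strip b -> strip c -> triangle a b c u ->
  others u -> (cy u = 0 /\ t%:R < cx u) \/ (cy u = M /\ J < cx u).
Proof.
facts; move=> [a1 /andP[a2 a3] a4] [b1 /andP[b2 b3] b4] [d1 /andP[d2 d3] d4] hu hL.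
have lf : linear3 (fun v => (k - g) * cz v) by move=> r s v w; rewrite lin_cz; ring.
have sq : 0 <= (k - g) * (k - g) by rewrite -expr2; exact: sqr_ge0.
have lo v : cz v = g \/ cz v = k -> - ((k - g) * cz v) <= - ((k - g) * g).
  by case=> ->; lra.
have hi v : cz v = g \/ cz v = k -> (k - g) * cz v <= (k - g) * k.
  by case=> ->; lra.
have u1 : (k - g) * g <= (k - g) * cz u.
  by rewrite -lerN2; apply: (triangle_le (linN lf)) hu; exact: lo.
have u2 : (k - g) * cz u <= (k - g) * k by apply: (triangle_le lf) hu; exact: hi.
apply: others_strip => //.
- apply/andP; split; last exact: (triangle_le lin_cy) hu.
  by rewrite -lerN2; apply: (triangle_le (linN lin_cy)) hu; rewrite lerN2.
- apply: lt_le_trans J0 _.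
  by rewrite -lerN2; apply: (triangle_le (linN lin_cx)) hu; rewrite lerN2.
have pos : 0 < (k - g) * (k - g).
  by rewrite -expr2 exprn_even_gt0 //= subr_eq0 eq_sym.
rewrite -(pmulr_rge0 _ pos) mulrACA; apply: mulr_ge0; lra.
Qed.

Ltac strip := facts; split; rewrite !c_pt;
  [lra | apply/andP; split; lra | first [by left | by right | assumption]].

Let foot_at u : foot u -> cx u = t%:R /\ cy u = 0.
Proof. by move=> /segmentP[x]; rewrite !c_pt => -[_ -> -> _]; split; ring. Qed.

Lemma drop_end :
  isotopic (base `|` segment A D) (others `|` foot `|` segment D F `|` segment E D).
Proof.
facts; apply: iso_sym.
apply: (@iso_delta _ _ _ (others `|` foot `|` segment D F) E D A).
- by [].
- by rewrite /base; set_ac.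
- by apply: (indep_second lin_cy lin_cx); rewrite !c_pt; lra.
move=> u hL hu.
case: hL => [[hL|/foot_at[ex _]]|hL].
- have [[_ hx]|[hy hx]] := others_triangle (ltac:(strip) : strip E) (ltac:(strip) : strip D)
    (ltac:(strip) : strip A) hu hL.
    suff : cx u < cx u by rewrite ltxx.
    by apply: le_lt_trans hx; apply: (triangle_le lin_cx) hu; rewrite c_pt; lra.
  have e : u = A.
    move: hu; rewrite triangleAC triangleC => hu.
    by apply: (triangle_vertex lin_cy) hu _; rewrite !c_pt ?hy; lra.
  by move: hx; rewrite e c_pt ltxx.
- by left; apply: (triangle_vertex lin_cx) hu _; rewrite !c_pt ?ex; lra.
have lf : linear3 (fun v => (k - g) * cz v) by move=> r s v w; rewrite lin_cz; ring.
have pos : 0 < (k - g) * (k - g).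
  by rewrite -expr2 exprn_even_gt0 //= subr_eq0 eq_sym.
have ez : cz u = k by move: hL => /segmentP[x]; rewrite !c_pt => -[_ _ _ ->]; ring.
right; rewrite triangleC in hu; apply: (triangle_vertex lf) hu _; rewrite !c_pt ?ez; lra.
Qed.

Let below_E b c u : triangle E b c u -> cy u = 0 -> cy b = 0 -> cy c = M -> segment E b u.
Proof.
facts; move=> hu hy b0 cM.
by apply: (triangle_edge (linN lin_cy)) hu _; rewrite ?b0 ?cM ?hy c_pt; lra.
Qed.

Let above_F a c u : triangle a F c u -> cy u = M -> cy a = 0 -> cy c = 0 -> u = F.
Proof.
facts; rewrite triangleC => hu hy b0 cM.
by apply: (triangle_vertex lin_cy) hu _; rewrite ?b0 ?cM ?hy c_pt; lra.
Qed.

Lemma drop_start :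
  isotopic (others `|` foot `|` segment D F `|` segment E D) (others `|` foot `|` segment E F).
Proof.
facts; apply: iso_sym; apply: (@iso_delta _ _ _ (others `|` foot) E F D).
- by [].
- by set_ac.
- by apply: (indep_third lin_cy lin_cx); rewrite !c_pt; lra.
move=> u hL hu.
have low : cy u = 0 -> t%:R <= cx u -> u = E.
  move=> hy hx; rewrite triangleAC in hu.
  have hs := below_E hu hy; rewrite !c_pt in hs; move: (hs erefl erefl) => {}hs.
  rewrite segmentC in hs.
  by apply: (segment_end lin_cx) hs _; rewrite !c_pt; lra.
case: hL => [hL|/foot_at[ex ey]]; last by left; apply: low; rewrite ?ex.
have [[hy hx]|[hy hx]] := others_triangle (ltac:(strip) : strip E) (ltac:(strip) : strip F)
    (ltac:(strip) : strip D) hu hL.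
  by left; apply: low => //; exact: ltW.
by right; apply: above_F hu hy _ _; rewrite c_pt.
Qed.

(** The corner above the start of a strand slides along its post. *)
Let slide x y : (x = g \/ x = k) -> (y = g \/ y = k) -> 0 < x * y -> x * x < x * y ->
  isotopic (others `|` segment (pt t%:R 0 0) (pt t%:R 0 x) `|` segment (pt t%:R 0 x) F)
           (others `|` segment (pt t%:R 0 0) (pt t%:R 0 y) `|` segment (pt t%:R 0 y) F).
Proof.
facts; move=> hx hy xy_gt0 xy.
have x0 : x != 0 by apply/eqP => e; move: xy; rewrite e !mul0r ltxx.
have y0 : y != 0 by apply/eqP => e; move: xy_gt0; rewrite e mulr0 ltxx.
have xx : 0 < x * x by rewrite -expr2 exprn_even_gt0.
have yy : 0 < y * y by rewrite -expr2 exprn_even_gt0.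
have hyy : y * x <= y * y by nra.
apply: (@iso_delta _ _ _ (others `|` segment (pt t%:R 0 0) (pt t%:R 0 x))
  (pt t%:R 0 x) F (pt t%:R 0 y)).
- by [].
- rewrite (@segment_split _ (pt t%:R 0 0) (pt t%:R 0 y) (pt t%:R 0 x)); first by set_ac.
  apply/segmentP; exists (x / y); rewrite !c_pt; split; [|ring|ring|by field].
  have -> : x / y = (x * y) / (y * y) by field.
  by apply/andP; split; [rewrite divr_ge0 // ltW|rewrite ler_pdivrMr // mul1r; lra].
- by apply: (indep_third lin_cy lin_cz); rewrite !c_pt; [|lra|move=> e; move: xy; rewrite e ltxx].
move=> u hL hu.
have low : cy u = 0 -> segment (pt t%:R 0 x) (pt t%:R 0 y) u.
  move=> h0; rewrite triangleAC in hu.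
  by apply: (triangle_edge (linN lin_cy)) hu _; rewrite ?h0 !c_pt; lra.
case: hL => [hL|hL].
  have [[h0 hxu]|[hM _]] := others_triangle (ltac:(strip) : strip (pt t%:R 0 x))
    (ltac:(strip) : strip F) (ltac:(strip) : strip (pt t%:R 0 y)) hu hL.
    exfalso; move: hxu; apply/negP; rewrite -leNgt.
    move: (low h0) => /segmentP[r]; rewrite !c_pt => -[_ -> _ _]; lra.
  by right; apply: above_F hu hM _ _; rewrite c_pt.
left; move: (hL) => /segmentP[r]; rewrite !c_pt => -[/andP[r0 r1] ex ey ez].
have h0 : cy u = 0 by rewrite ey; ring.
move: (low h0) => /segmentP[s]; rewrite !c_pt => -[/andP[s0 s1] _ _ ez'].
have e : x * ((1 - s) * x + s * y) = x * (r * x) by rewrite -ez' ez; ring.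
have r1' : r = 1 by nra.
by apply: pt_ext; rewrite !c_pt ?ex ?ez ?r1' //; ring.
Qed.

(** The strand that remains goes from height [g] to height [k]. The corner at
    its start has to move away from the plane or towards it, according to which of
    the two heights is closer to 0. *)
Lemma level_start :
  isotopic (others `|` foot `|` segment E F)
    (others `|` segment (pt t%:R 0 0) (pt t%:R 0 k) `|` segment (pt t%:R 0 k) F).
Proof.
have [h|h] := ltP (g * g) (g * k).
  by apply: slide => //; [left|right].
apply: iso_sym; apply: slide; [by right|by left|by rewrite mulrC|].
have [g1|g1|e] := ltrgt0P g; last by move: gk; rewrite e mul0r ltxx.
  have k1 : 0 < k by rewrite -(pmulr_rgt0 _ g1).
  rewrite ltr_pM2l // lt_neqAle eq_sym g_neq_k /=.
  by rewrite -(ler_pM2l g1).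
have k1 : k < 0 by rewrite -(nmulr_rgt0 _ g1).
rewrite ltr_nM2l // lt_neqAle g_neq_k /=.
by rewrite -(ler_nM2l g1).
Qed.

Lemma merge_strands :
  isotopic (flat_closure m ((t, j, g) :: (j, q, k) :: ss)) (flat_closure m ((t, q, k) :: ss)).
Proof.
apply: iso_trans (iso_trans _ (iso_trans drop_lower_right _)) _.
- apply: (@iso_eq _ _ (base `|` segment A w1 `|` segment w0 D `|` closing_arc R m j)).
  rewrite !flat_closure_cons /piece /flat_strand /= /base /others /foot; set_ac.
- apply: iso_trans drop_upper_right _; apply: iso_trans drop_upper_left _.
  apply: iso_trans drop_lower_left _; apply: iso_trans drop_post_end _.
  apply: iso_trans drop_post_start _; apply: iso_trans drop_end _.
  apply: iso_trans drop_start _; exact: level_start.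
- by apply: iso_eq; rewrite !flat_closure_cons /piece /flat_strand /= /others; set_ac.
Qed.

End Merge.

(** * Closures of cyclic shifts *)

Section Unknots.
Context {R : realType}.
Variables (p m : nat).
Hypothesis m_gt0 : (0 < m)%N.

(** These heights order the odd strands above the even ones, and strands of equal
    parity by their labels. Their absolute values are distinct and exceed 1, the
    height of the crossings. The signs separate the parities, so that the posts of
    odd strands are above the plane and those of even strands below it. *)
Definition height (s : nat) : R := if odd s then s%:R + 1 else s%:R - 3 * p%:R.

Lemma trivial_iso (K K' : set 'rV[R]_3) : isotopic K K' -> trivial_knot K' -> trivial_knot K.
Proof. by move=> h [a [b [c [hi h']]]]; exists a, b, c; split=> //; exact: iso_trans h h'. Qed.

(** Lowered to the plane, a single strand and its arc form a rectangle. *)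
Lemma trivial_strand h : (0 < p)%N -> h != 0 ->
  trivial_knot (flat_closure m [:: (p, p, h : R)]).
Proof.
move=> p0 h0; apply: trivial_iso.
  by apply: iso_sym; apply: raise_strand.
have {}p0 : 0 < p%:R :> R by rewrite ltr0n.
have M0 : 0 < m%:R :> R by rewrite ltr0n.
pose c1 := @pt3 R p%:R (m%:R + p%:R) 0; pose c2 := @pt3 R (- p%:R) (m%:R + p%:R) 0.
pose c3 := @pt3 R (- p%:R) (- p%:R) 0; pose c4 := @pt3 R p%:R (- p%:R) 0.
have side y : - p%:R <= y <= m%:R + p%:R -> segment c4 c1 (pt3 p%:R y 0).
  move=> /andP[y0 y1]; have d0 : 0 < m%:R + 2 * p%:R :> R by lra.
  apply/segmentP; exists ((y + p%:R) / (m%:R + 2 * p%:R)); rewrite !c_pt; split; [|ring| |ring].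
    by apply/andP; split; [rewrite divr_ge0 //|rewrite ler_pdivrMr // mul1r]; lra.
  by field; apply: lt0r_neq0.
have eK : flat_closure m [:: (p, p, 0 : R)] =
    (segment c4 c1 `|` segment c3 c4) `|` (segment c1 c2 `|` segment c2 c3).
  rewrite flat_closure_cons /piece /flat_strand /= arcE -/c1 -/c2 -/c3 -/c4.
  rewrite (_ : flat_closure m [::] = set0) ?setU0; last first.
    by apply/seteqP; split=> u // [].
  rewrite (@segment_split _ c4 c1 (pt3 p%:R m%:R 0)); last by apply: side; lra.
  rewrite (@segment_split _ c4 (pt3 p%:R m%:R 0) (pt3 p%:R 0 0)); last first.
    have d0 : 0 < m%:R + p%:R :> R by lra.
    apply/segmentP; exists (p%:R / (m%:R + p%:R)); rewrite !c_pt; split; [|ring| |ring].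
      by apply/andP; split; [rewrite divr_ge0 //|rewrite ler_pdivrMr // mul1r]; lra.
    by field; apply: lt0r_neq0; lra.
  rewrite !(segment_eq (erefl (pt3 _ _ _))).
  rewrite (setUidr (_ : [set pt3 p%:R 0 0] `<=` _)); last by move=> _ ->; exact: segment_l.
  rewrite (setUidl (_ : [set pt3 p%:R m%:R 0] `<=` _)); last by move=> _ ->; exact: segment_r.
  by set_ac.
exists c1, c3, c4; split.
  by apply: (indep_third lin_cx lin_cy); rewrite !c_pt; lra.
rewrite eK; apply: iso_sym.
apply: (@iso_delta _ _ _ (segment c4 c1 `|` segment c3 c4) c1 c3 c2).
- by rewrite -[polyline _ _]/(segment c1 c3 `|` polyline c3 [:: c4; c1]) polyline2; set_ac.
- by [].
- by apply: (indep_first lin_cx lin_cy); rewrite !c_pt; lra.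
move=> u [] /segmentP[x]; rewrite !c_pt => -[hx ex ey _] hu.
  by left; apply: (triangle_vertex lin_cx) hu _; rewrite !c_pt ?ex; lra.
right; rewrite triangleC in hu.
by apply: (triangle_vertex (linN lin_cy)) hu _; rewrite !c_pt ?ey; lra.
Qed.

(** The closure of the permutation that moves every strand by one position to the
    left, after the [j.-1] innermost loops have been removed: the strand from [j]
    to [p] crosses all others. *)
Definition shift1 j : seq (nat * nat * R) :=
  (j, p, 2) :: [seq (t, t.-1, height t) | t <- iota j.+1 (p - j)].

Lemma mem_tail f a n (x : nat * nat * R) :
  x \in [seq (t, f t, height t) | t <- iota a n] ->
  exists2 t, (a <= t < a + n)%N & x = (t, f t, height t).
Proof. by case/mapP=> t; rewrite mem_iota => ht ->; exists t. Qed.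

Lemma apart (h g k : R) : (g < h /\ k < h) \/ (h < g /\ h < k) -> (h - g) * (k - h) < 0.
Proof.
by case=> -[h1 h2]; [rewrite pmulr_rlt0|rewrite nmulr_rlt0]; lra.
Qed.

Lemma height_cases (s : nat) : (0 < s <= p)%N ->
  (odd s /\ height s = s%:R + 1) \/
  [/\ ~~ odd s, height s = s%:R - 3 * p%:R & height s < -1].
Proof.
move=> /andP[s0 sp]; rewrite /height; case: (boolP (odd s)) => os; [by left|right; split=> //].
have : s%:R <= p%:R :> R by rewrite ler_nat.
have : 1 <= s%:R :> R by rewrite ler1n.
lra.
Qed.


(** The strand from [j.+1] crosses only the strand from [j], so it can be given a
    height next to that of the latter, and the two merge. *)
Lemma unknot_shift1 j : (0 < j <= p)%N -> trivial_knot (flat_closure m (shift1 j)).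
Proof.
move=> /andP[j0 jp]; rewrite /shift1; move en : (p - j)%N => n.
elim: n j j0 jp en => [|n IH] j j0 jp en.
  have -> : j = p by lia.
  by apply: trivial_strand; [lia|rewrite pnatr_eq0].
have jlt : (j < p)%N by lia.
have tP x : x \in [seq (t, t.-1, height t) | t <- iota j.+2 n] ->
    exists2 t, (j.+2 <= t <= p)%N & x = (t, t.-1, height t).
  by case/mem_tail=> t ht ->; exists t => //; lia.
have hgt t : (j.+2 <= t <= p)%N -> j%:R + 3 <= height t \/ height t < -1.
  move=> ht; have [|[_ ->]|[_ _ ?]] := @height_cases t; [lia| |by right].
  have : j.+2%:R <= t%:R :> R by rewrite ler_nat; lia.
  by rewrite -addn2 natrD; left; lra.
have j1 : 1 <= j%:R :> R by rewrite ler1n.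
have jlt' : j%:R + 1 <= p%:R :> R by rewrite natr1 ler_nat.
(* Height 2 is that of the strand crossing all others. *)
have step (g : R) : 0 < g -> g != 2 -> g < j%:R + 3 ->
    trivial_knot (flat_closure m ((j.+1, j, g) :: (j, p, 2)
      :: [seq (t, t.-1, height t) | t <- iota j.+2 n])).
  move=> g0 g2 gj; apply: trivial_iso (IH j.+1 _ _ _); [|by []|by []|by lia].
  apply: merge_strands => //; first by apply: mulr_gt0.
  move=> x /tP[t ht ->] /=; split; [lia|lia|lia| |left; lia].
  by apply: apart; case: (hgt t ht) => h; [left|right]; lra.
have -> : flat_closure m ((j, p, 2) :: [seq (t, t.-1, height t) | t <- iota j.+1 n.+1]) =
    flat_closure m ((j.+1, j, height j.+1) :: (j, p, 2)
      :: [seq (t, t.-1, height t) | t <- iota j.+2 n]).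
  by apply: flat_closure_eq => x; rewrite /= !inE orbCA.
have [|[oj hj]|[_ _ hj]] := @height_cases j.+1; first by lia.
  have j2 : 2 <= j%:R :> R by rewrite ler_nat; lia.
  by rewrite hj -natr1; apply: step; [lra|apply/eqP; lra|lra].
(* If j.+1 is even, the heights of other even strands are between its height and 2, so it
   first moves to height 1. *)
have flip (g : R) : g != 0 -> g < 2 -> isotopic
    (flat_closure m ((j.+1, j, 0) :: (j, p, 2) :: [seq (t, t.-1, height t) | t <- iota j.+2 n]))
    (flat_closure m ((j.+1, j, g) :: (j, p, 2) :: [seq (t, t.-1, height t) | t <- iota j.+2 n])).
  move=> g0 g2; apply: raise_strand => // x; rewrite inE => /orP[/eqP->|/tP[t ht ->]] /=.
    by split; [lia|lia|lia|constructor 1; rewrite pmulr_rlt0; lra].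
  by split; [lia|lia|lia|constructor 3; lia].
apply: trivial_iso (step 1 _ _ _); [|lra|apply/eqP; lra|lra].
by apply: iso_trans (iso_sym (flip _ _ _)) (flip _ _ _); [apply/eqP| |exact: oner_neq0|]; lra.
Qed.

(** After removal of [j.-1] loops, the permutation that moves every strand by two
    positions to the left leaves two strands that cross the others, from [j] and
    [j.+1]. Both arise by merging strands of one parity, and they keep the targets
    and heights of the original strands 1 and 2. *)
Definition target j := if odd j then p.-1 else p.
Definition level j : R := if odd j then 2 else 2 - 3 * p%:R.

Definition shift2 j : seq (nat * nat * R) :=
  (j, target j, level j) :: (j.+1, target j.+1, level j.+1)
  :: [seq (t, t.-2, height t) | t <- iota j.+2 (p - j.+1)].

(** Among the strands of one parity, the one from [j.+2] is next in height to the
    one from [j], so the two merge directly. For odd [p] this leaves the strands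
    from [p.-1] to [p] and from [p] to [p.-1], which cross once. *)
Lemma unknot_shift2 j : odd p -> (0 < j < p)%N -> trivial_knot (flat_closure m (shift2 j)).
Proof.
move=> op /andP[j0 jp]; rewrite /shift2; move en : (p - j.+1)%N => n.
have p2 : p <> 2 by move=> e; move: op; rewrite e.
have p3 : (2 < p)%N by lia.
have pR : 3 <= p%:R :> R by rewrite ler_nat.
elim: n j j0 jp en => [|n IH] j j0 jp en.
  have ep : p = j.+1 by lia.
  have ej : ~~ odd j by move: op; rewrite ep.
  have flip (h : R) : h != 0 -> 2 - 3 * p%:R < h -> isotopic
      (flat_closure m [:: (p, p.-1, 0); (p.-1, p, 2 - 3 * p%:R)])
      (flat_closure m [:: (p, p.-1, h); (p.-1, p, 2 - 3 * p%:R)]).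
    move=> h0 hh; apply: raise_strand => //; [lia|lia|].
    move=> x; rewrite inE => /eqP-> /=.
    by split; [lia|lia|lia|constructor 1; rewrite nmulr_rlt0; lra].
  rewrite /target /level -ep op (negbTE ej) /=.
  have -> : flat_closure m [:: (j, p, 2 - 3 * p%:R); (p, p.-1, 2 : R)] =
      flat_closure m [:: (p, p.-1, 2); (p.-1, p, 2 - 3 * p%:R)].
    apply: flat_closure_eq => x; rewrite !inE orbC; congr (_ || (x == (_, _, _))); lia.
  apply: trivial_iso (trivial_strand (h := 2 - 3 * p%:R) _ _); [|lia|apply/eqP; lra].
  apply: iso_trans (iso_sym (flip 2 _ _)) (iso_trans (flip (-1) _ _) _);
    [apply/eqP; lra|lra|apply/eqP; lra|lra|].
  apply: merge_strands => //; [lia|lia|lia| |apply/eqP; lra].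
  by rewrite nmulr_rgt0; lra.
have jlt : (j.+1 < p)%N by lia.
have tP x : x \in [seq (t, t.-2, height t) | t <- iota j.+3 n] ->
    exists2 t, (j.+3 <= t <= p)%N & x = (t, t.-2, height t).
  by case/mem_tail=> t ht ->; exists t => //; lia.
have j1 : 1 <= j%:R :> R by rewrite ler1n.
have jlt' : j%:R + 2 <= p%:R :> R by rewrite -natrD ler_nat; lia.
have e2 : j.+2%:R = j%:R + 2 :> R by rewrite -addn2 natrD.
apply: trivial_iso (IH j.+1 _ _ _); [|by []|by []|by lia].
apply: (iso_trans _ (iso_trans (@merge_strands _ m j.+2 j (target j) (height j.+2) (level j)
  ((j.+1, target j.+1, level j.+1) :: [seq (t, t.-2, height t) | t <- iota j.+3 n])
  m_gt0 j0 _ _ _ _ _) _)).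
- apply: iso_eq; apply: flat_closure_eq => x; rewrite /= !inE.
  by rewrite orbC -!orbA; do !bool_congr.
- exact: ltnW.
- by rewrite /target; case: ifP; lia.
- by rewrite /height /level /= negbK; case: (odd j); [apply: mulr_gt0|rewrite nmulr_rgt0]; lra.
- by rewrite /height /level /= negbK; case: (odd j); apply/eqP; lra.
- move=> x; rewrite inE => /orP[/eqP->|/tP[t ht ->]] /=.
    split; [rewrite /target; case: ifP; lia|lia|rewrite /target /=; case: (odd j) => /=; lia| |right].
      by apply: apart; rewrite /height /level /= negbK; case: (odd j) => /=; [right|left]; lra.
    by rewrite /level /=; case: (odd j) => /=; [rewrite nmulr_rlt0|rewrite pmulr_rlt0]; lra.
  split; [lia|lia|rewrite /target; case: ifP; lia| |left; lia].
  have : j.+3%:R <= t%:R :> R by rewrite ler_nat; lia.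
  rewrite -addn3 natrD => hjt.
  have htp : t%:R <= p%:R :> R by rewrite ler_nat; lia.
  by apply: apart; rewrite /height /level /= negbK; case: (odd j) => /=; case: (odd t) => /=; lra.
- have eT : target j.+2 = target j by rewrite /target /= negbK.
  have eL : level j.+2 = level j by rewrite /level /= negbK.
  by apply: iso_eq; apply: flat_closure_eq => x; rewrite eT eL !inE orbCA.
Qed.

End Unknots.

(** * The strands of a weaving braid *)

Section WeavingWord.
Variable p : nat.
Hypothesis p_gt1 : (1 < p)%N.

Definition weave_index k := (k %% p.-1).+1.
Definition weave_sign k := odd (weave_index k).

Lemma weaving_word q : weaving_braid p q = word_of weave_index weave_sign (q * p.-1).
Proof.
rewrite /weaving_braid /word_of; elim: q => [|q IH] //=.
rewrite IH mulSn iotaD map_cat add0n; congr (_ ++ _).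
  rewrite (iotaDl 1 0) -map_comp; apply/eq_in_map => k; rewrite mem_iota => /andP[_ hk] /=.
  by rewrite /weave_sign /weave_index modn_small.
have -> : iota p.-1 (q * p.-1) = map (addn p.-1) (iota 0 (q * p.-1)) by rewrite -iotaDl addn0.
rewrite -map_comp; apply/eq_map => k /=.
by rewrite /weave_sign /weave_index modnDl.
Qed.

Lemma weave_valid m : valid p m weave_index.
Proof.
move=> k _; rewrite /weave_index /=.
have := ltn_pmod k (_ : 0 < p.-1)%N; lia.
Qed.

(** Unlike positions and labels, places within a row are counted from 0. *)
Definition row_place r s := ((s.-1 + p.-1 * r) %% p)%N.

Definition place_in_row a e := if a == 0%N then e else if (a <= e)%N then a.-1 else a.

Lemma row_placeS r s : row_place r.+1 s = place_in_row (row_place r s) p.-1.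
Proof.
rewrite /row_place mulnSr addnA -modnDml.
have : ((s.-1 + p.-1 * r) %% p < p)%N by rewrite ltn_pmod //; lia.
move: (_ %% p)%N => a ap; rewrite /place_in_row.
case: eqVneq => [->|a0]; first by rewrite add0n modn_small //; lia.
have -> : (a <= p.-1)%N by lia.
have -> : (a + p.-1 = a.-1 + p)%N by lia.
by rewrite modnDr modn_small //; lia.
Qed.

(** In a row, the strand at place 0 moves across all others, and each of these
    moves by one place to the left as it is crossed. *)
Lemma pos_weave s r e : (0 < s <= p)%N -> (e <= p.-1)%N ->
  pos weave_index s (r * p.-1 + e) = (place_in_row (row_place r s) e).+1.
Proof.
move=> hs; elim: r e => [|r IHr]; last first.
  have start : pos weave_index s (r.+1 * p.-1 + 0) = (place_in_row (row_place r.+1 s) 0).+1.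
    rewrite addn0 mulSnr IHr // row_placeS.
    by rewrite /place_in_row; repeat case: ifP; lia.
  elim=> [|e IHe] he //; rewrite addnS /= IHe; last exact: ltnW.
  by rewrite /weave_index modnMDl modn_small // /swap_at /place_in_row; repeat case: ifP; lia.
elim=> [|e IHe] he.
  rewrite mul0n /= /row_place muln0 addn0 modn_small; last by lia.
  by rewrite /place_in_row; repeat case: ifP; lia.
rewrite addnS /= IHe; last exact: ltnW.
by rewrite /weave_index modnMDl modn_small // /swap_at /place_in_row; repeat case: ifP; lia.
Qed.

(** Every row moves the strands cyclically by one place. *)
Lemma strand_of_place r s : (0 < s <= p)%N -> s.-1 = ((row_place r s + r) %% p)%N.
Proof.
move=> hs; rewrite /row_place modnDml -addnA.
have -> : (p.-1 * r + r = r * p)%N by rewrite -mulSnr prednK 1?mulnC //; lia.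
by rewrite addnC modnMDl modn_small //; lia.
Qed.

(** The order of the heights of strands [a.+1] and [b.+1], see [height_above]. *)
Definition above a b := (~~ odd a && odd b) || ((odd a == odd b) && (b < a)%N).

(** In row [r], strand [r %% p] (counted from 0) crosses strand [(r + d) %% p] at
    the [d]-th letter; this sign lets the higher of the two pass over. *)
Definition layer_sign k :=
  let r := (k %/ p.-1)%N in above (r %% p) ((r + weave_index k) %% p).

Lemma height_above (R : realType) a b : (a < p)%N -> (b < p)%N -> a <> b ->
  ((height p b.+1 : R) < height p a.+1) = above a b.
Proof.
move=> ap bp ab; rewrite /height /above /=.
have pR : 0 < p%:R :> R by rewrite ltr0n; lia.
have aR : a.+1%:R <= p%:R :> R by rewrite ler_nat.
have bR : b.+1%:R <= p%:R :> R by rewrite ler_nat.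
have a0 : 0 <= a.+1%:R :> R by [].
have b0 : 0 <= b.+1%:R :> R by [].
case: (odd a); case: (odd b) => //=; rewrite ?ltrD2r ?ltr_nat ?ltnS //.
  by apply/negbTE; rewrite -leNgt; lra.
by lra.
Qed.

Lemma weave_layered (R : realType) m : layered p m weave_index layer_sign (height p : nat -> R).
Proof.
move=> k s t _ hs ht.
have P0 : (0 < p.-1)%N by lia.
pose r := (k %/ p.-1)%N; pose e := (k %% p.-1)%N.
have ek : k = (r * p.-1 + e)%N := divn_eq k p.-1.
have he : (e < p.-1)%N := ltn_pmod k P0.
have ei : weave_index k = e.+1 by [].
rewrite {1}ek {2}ek !pos_weave ?(ltnW he) // ei => -[hps] -[hpt].
have rs : row_place r s = 0%N.
  by move: hps; rewrite /place_in_row; repeat case: ifP; lia.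
have rt : row_place r t = e.+1.
  by move: hpt; rewrite /place_in_row; repeat case: ifP; lia.
have es := strand_of_place r hs; have et := strand_of_place r ht.
rewrite rs add0n in es; rewrite rt addnC in et.
rewrite /layer_sign -/r ei -es -et -(@height_above R); last 3 first.
- lia.
- lia.
- move=> est; have : s = t by lia.
  by move=> st; move: rs rt; rewrite st => ->.
by rewrite !prednK //; lia.
Qed.

Lemma pos_weave_end s q : (0 < s <= p)%N ->
  pos weave_index s (q * p.-1) = ((s.-1 + p.-1 * q) %% p).+1.
Proof.
move=> hs; rewrite -[(q * _)%N]addn0 pos_weave //; congr _.+1.
by rewrite /place_in_row -/(row_place q s); repeat case: ifP; lia.
Qed.

Lemma weave_end1 s n : (0 < s <= p)%N ->
  pos weave_index s ((n * p + 1) * p.-1) = if s == 1%N then p else s.-1.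
Proof.
move=> hs; rewrite pos_weave_end // mulnDr muln1 addnCA mulnA modnMDl.
case: eqVneq => [->|s1]; first by rewrite add0n modn_small //; lia.
have -> : (s.-1 + p.-1 = s.-2 + p)%N by lia.
by rewrite modnDr modn_small //; lia.
Qed.

Lemma weave_end2 s n : (0 < s <= p)%N -> pos weave_index s ((n * p + 2) * p.-1) =
  if s == 1%N then p.-1 else if s == 2 then p else s.-2.
Proof.
move=> hs; rewrite pos_weave_end // mulnDr addnCA mulnA modnMDl.
case: eqVneq => [->|s1].
  have -> : (1.-1 + p.-1 * 2 = p.-2 + p)%N by lia.
  by rewrite modnDr modn_small //; lia.
case: eqVneq => [->|s2].
  have -> : (2.-1 + p.-1 * 2 = p.-1 + p)%N by lia.
  by rewrite modnDr modn_small //; lia.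
have -> : (s.-1 + p.-1 * 2 = s.-2.-1 + p + p)%N by lia.
by rewrite !modnDr modn_small //; lia.
Qed.

End WeavingWord.

(** * The number of crossing changes *)

Section Counting.
Variable p : nat.
Hypothesis p_gt1 : (1 < p)%N.

(** The number of crossings to be changed in row [r]. *)
Definition row_cost r : nat :=
  (\sum_(0 <= e < p.-1) (odd e.+1 != above (r %% p) ((r + e.+1) %% p)))%N.

Lemma cost_rows q :
  (\sum_(0 <= k < q * p.-1) (weave_sign p k != layer_sign p k))%N
    = (\sum_(0 <= r < q) row_cost r)%N.
Proof.
elim: q => [|q IH]; first by rewrite mul0n !big_nil.
rewrite big_nat_recr //= -IH mulSnr (@big_cat_nat _ _ _ (q * p.-1)) ?leq_addr //=.
congr (_ + _)%N; rewrite -[X in (\sum_(X <= _ < _) _)%N]add0n big_addn addKn.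
apply: eq_big_nat => e /andP[_ he].
rewrite /weave_sign /layer_sign /weave_index addnC modnMDl modn_small //.
by rewrite divnMDl ?divn_small ?addn0 //; lia.
Qed.

Lemma row_cost_mod r : row_cost (r %% p) = row_cost r.
Proof. by apply: eq_big_nat => e _; rewrite modn_mod modnDml. Qed.

Lemma cost_blocks n x : (\sum_(0 <= r < n * p + x) row_cost r)%N =
  (n * (\sum_(0 <= r < p) row_cost r) + \sum_(0 <= r < x) row_cost r)%N.
Proof.
elim: n => [|n IH] //.
rewrite mulSn -addnA (@big_cat_nat _ _ _ p) ?leq_addr //= mulSn -addnA -IH.
congr (_ + _)%N; rewrite -[X in (\sum_(X <= _ < _) _)%N]add0n big_addn addKn.
by apply: eq_big_nat => r _; rewrite -row_cost_mod modnDr row_cost_mod.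
Qed.

(** The sum over the letters of row [r] is rewritten as a sum over the strands [b]
    crossed there: first those with [b > r], then those with [b < r]. *)
Lemma row_costE r : (r < p)%N -> row_cost r =
  (\sum_(r.+1 <= b < p) (odd r && ~~ odd b) +
   \sum_(0 <= b < r) ((odd b (+) odd p (+) odd r) != above r b))%N.
Proof.
move=> rp; rewrite /row_cost (@big_cat_nat _ _ _ (p.-1 - r)) /=; [|lia|lia].
congr (_ + _)%N.
  rewrite -[r.+1 in RHS]add0n big_addn (_ : (p - r.+1 = p.-1 - r)%N); last by lia.
  apply: eq_big_nat => e he; rewrite !modn_small; [|lia|lia].
  rewrite (addnS e) (addnC e) addnS /above /= ltnNge leqW ?leq_addr // andbF orbF oddD.
  by case: (odd r); case: (odd e).
rewrite -[X in (\sum_(X <= _ < _) _)%N]add0n big_addn (_ : (p.-1 - (p.-1 - r) = r)%N); last by lia.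
apply: eq_big_nat => b hb; congr (nat_of_bool (_ != above _ _)); last 2 first.
- by rewrite modn_small.
- by rewrite (_ : (r + (b + (p.-1 - r)).+1 = b + p)%N) ?modnDr ?modn_small //; lia.
have : odd (b + (p.-1 - r)).+1 (+) odd r = odd (b + p).
  by rewrite -oddD; congr odd; lia.
by rewrite oddD => <-; rewrite -addbA addbb addbF.
Qed.

Definition low_pairs N : nat := (\sum_(0 <= r < N) \sum_(0 <= b < r) (~~ odd r && odd b))%N.

Lemma high_pairs N :
  (\sum_(0 <= r < N) \sum_(r.+1 <= b < N) (odd r && ~~ odd b))%N = low_pairs N.
Proof.
rewrite /low_pairs; elim: N => [|N IH]; first by rewrite !big_nil.
rewrite big_nat_recr //= (@big_geq _ _ _ N.+1 N.+1) // addn0 [RHS]big_nat_recr //= -IH.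
rewrite -big_split /=; apply: eq_big_nat => r /andP[_ rN].
by rewrite big_nat_recr //= [in RHS]andbC.
Qed.

Lemma low_pairsS N : low_pairs N.+1 = (low_pairs N + ~~ odd N * N./2)%N.
Proof.
have odds r : (\sum_(0 <= b < r) odd b)%N = r./2.
  elim: r => [|r IH]; first by rewrite big_nil.
  by rewrite big_nat_recr //= IH uphalf_half addnC.
rewrite /low_pairs big_nat_recr //= -odds big_distrr /=; congr (_ + _)%N.
by apply: eq_bigr => b _; rewrite mulnb.
Qed.

Lemma low_pairs_odd M : (low_pairs M.*2.+1 * 2 = M * M.+1)%N.
Proof.
elim: M => [|M IH]; first by rewrite low_pairsS /low_pairs big_nil.
rewrite doubleS low_pairsS (low_pairsS M.*2.+1) /= odd_double /= uphalf_double.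
rewrite mul0n addn0 mul1n mulnDl IH; lia.
Qed.

(** For odd [p], the same strand of a pair passes over both times. It is the wrong
    one exactly when the lower label, counted from 0, is odd and the higher one
    even. *)
Lemma block_cost_odd M : p = M.*2.+1 -> (\sum_(0 <= r < p) row_cost r = M * M.+1)%N.
Proof.
move=> ep; have op : odd p by rewrite ep /= odd_double.
rewrite -low_pairs_odd -ep muln2 -addnn -{1}high_pairs /low_pairs -big_split /=.
apply: eq_big_nat => r /andP[_ rp]; rewrite row_costE //; congr (_ + _)%N.
apply: eq_big_nat => b /andP[_ br]; rewrite op /above br.
by case: (odd r); case: (odd b).
Qed.

(** For even [p], each strand of a pair passes over once, so exactly one of the two
    crossings is wrong. *)
Lemma block_cost_even : ~~ odd p -> (2 * \sum_(0 <= r < p) row_cost r = p * p.-1)%N.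
Proof.
move=> /negbTE op.
suff -> : (\sum_(0 <= r < p) row_cost r = \sum_(0 <= r < p) r)%N.
  rewrite mul2n -addnn; elim: p => [|n IH]; first by rewrite big_nil.
  by rewrite big_nat_recr //= addnACA IH; case: n {IH} => //=; lia.
have -> : (\sum_(0 <= r < p) row_cost r = low_pairs p +
    \sum_(0 <= r < p) \sum_(0 <= b < r) ((odd b (+) odd p (+) odd r) != above r b))%N.
  rewrite -high_pairs -big_split /=.
  by apply: eq_big_nat => r /andP[_ rp]; rewrite row_costE.
rewrite /low_pairs -big_split /=; apply: eq_big_nat => r _.
rewrite -big_split /= -[RHS]muln1 -[X in (X * _)%N]subn0 -sum_nat_const_nat.
apply: eq_big_nat => b /andP[_ br]; rewrite op /above br.
by case: (odd r); case: (odd b).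
Qed.

(** Counted from 0, strand 0 passes over the odd and under the even strands, as
    the heights prescribe. *)
Lemma row_cost0 : row_cost 0 = 0%N.
Proof.
rewrite /row_cost big1_seq // => e; rewrite mem_index_iota => /andP[_ he].
by rewrite mod0n add0n modn_small /above /= ?ltn0 ?andbF ?orbF ?eqxx //; lia.
Qed.

(** Counted from 0, strand 1 is the lowest one, and it passes over every second
    strand that it meets. *)
Lemma row_cost1 M : p = M.*2.+1 -> row_cost 1 = M.
Proof.
move=> ep; have M0 : (0 < M)%N by lia.
rewrite /row_cost ep /= modn_small; last by lia.
have tot N : (\sum_(0 <= e < N.*2) odd e.+1 = N)%N.
  elim: N => [|N IH]; first by rewrite big_nil.
  by rewrite doubleS !big_nat_recr //= IH odd_double /= addn1 addn0.
rewrite -[RHS]tot; apply: eq_bigr => e _; congr nat_of_bool.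
rewrite /above /=; set b := (_ %% _)%N.
by case: b => [|b]; case: (odd e) => //=; case: (odd b).
Qed.

End Counting.

(** * Unknotting weaving knots *)

Section UnknottingWeavingKnots.
Context {R : realType}.

Lemma unknotted_changes p m idx (sg sg' : nat -> bool) n : valid p m idx ->
  unknotted_by n (braid_closure R p (word_of idx sg' m)) ->
  unknotted_by (\sum_(0 <= k < m) (sg k != sg' k) + n) (braid_closure R p (word_of idx sg m)).
Proof.
move=> hv hn; pose mix i k := if (k < i)%N then sg k else sg' k.
have mixE : word_of idx (mix m) m = word_of idx sg m.
  by apply/eq_in_map => k; rewrite mem_iota /mix => /andP[_ ->].
rewrite -mixE.
suff main i : (i <= m)%N -> unknotted_by (\sum_(0 <= k < i) (sg k != sg' k) + n)
    (braid_closure R p (word_of idx (mix i) m)) by exact: main.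
elim: i => [|i IH] im; first by rewrite big_nil add0n.
rewrite big_nat_recr //=; case: eqVneq => [e|ne] /=.
  rewrite addn0; suff <- : mix i = mix i.+1 by apply: IH; exact: ltnW.
  by apply: funext => k; rewrite /mix ltnS [in RHS]leq_eqVlt; case: eqP => [->|_] //=; rewrite ltnn e.
rewrite addn1 addSn /=; exists (braid_closure R p (word_of idx (mix i.+1) m)).
exists (braid_closure R p (word_of idx (mix i) m)); split; [exact: rst_refl| |exact/IH/ltnW].
apply: change_letter hv im _ _.
  by rewrite /mix ltnn ltnSn; move: ne; case: (sg i); case: (sg' i).
by move=> j /eqP ji; rewrite /mix ltnS [in RHS]leq_eqVlt (negbTE ji).
Qed.

Lemma unknotting_number_le (K : set 'rV[R]_3) n : unknotted_by n K ->
  exists2 u, is_unknotting_number K u & (u <= n)%N.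
Proof.
move=> hn; have ex : exists n, `[< unknotted_by n K >] by exists n; apply/asboolP.
case: (ex_minnP ex) => u /asboolP hu hmin; exists u; last by apply: hmin; apply/asboolP.
by split=> // k hk; apply: hmin; apply/asboolP.
Qed.

Section Layered.
Variable p : nat.
Hypothesis p_gt2 : (2 < p)%N.

Lemma height_gt1 s : (0 < s <= p)%N -> 1 < `|height p s : R|.
Proof.
move=> hs; case: (@height_cases R _ _ hs) => [[os ->]|[_ _ h]].
  have s1 : 1 <= s%:R :> R by rewrite ler1n; lia.
  by rewrite ger0_norm; lra.
by rewrite ltr0_norm; lra.
Qed.

Lemma height_norm s : (0 < s <= p)%N ->
  `|height p s : R| = s%:R + 1 \/ `|height p s : R| = 3 * p%:R - s%:R.
Proof.
move=> hs; case: (@height_cases R _ _ hs) => [[_ ->]|[_ e h]].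
  by left; rewrite ger0_norm // addr_ge0.
by right; rewrite ltr0_norm; [rewrite e opprB|lra].
Qed.

Lemma height_norm_inj s t : (0 < s <= p)%N -> (0 < t <= p)%N ->
  `|height p s : R| = `|height p t| -> s = t.
Proof.
move=> hs ht.
have sp : s%:R <= p%:R :> R by rewrite ler_nat; lia.
have tp : t%:R <= p%:R :> R by rewrite ler_nat; lia.
have p3 : 3 <= p%:R :> R by rewrite ler_nat.
have s0 : 0 <= s%:R :> R by []. have t0 : 0 <= t%:R :> R by [].
move=> e; apply/eqP; rewrite -(eqr_nat R); apply/eqP; move: e.
by case: (height_norm hs) => ->; case: (height_norm ht) => -> e; lra.
Qed.

Lemma flatten_weave m : (0 < m)%N ->
  isotopic (braid_closure R p (word_of (weave_index p) (layer_sign p) m))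
    (flat_closure m [seq (s, pos (weave_index p) s m, height p s) | s <- iota 1 p]).
Proof.
move=> m0; have p1 : (1 < p)%N by lia.
have hv : valid p m (weave_index p) by exact: weave_valid.
rewrite closure_strands //; apply: iso_trans (flatten_strands (ht := height p) m0 hv _ _ _) _.
- exact: weave_layered.
- exact: height_gt1.
- exact: height_norm_inj.
apply: iso_eq; apply/seteqP; split=> u.
  case=> s /= hs hu; exists (s, pos (weave_index p) s m, height p s) => //=.
  by apply/mapP; exists s => //; rewrite mem_iota; lia.
case=> x /= /mapP[s]; rewrite mem_iota => hs -> hu.
by exists s => //=; lia.
Qed.

Lemma trivial_weave1 n :
  trivial_knot (braid_closure R p (word_of (weave_index p) (layer_sign p) ((n * p + 1) * p.-1))).
Proof.
have m0 : (0 < (n * p + 1) * p.-1)%N by rewrite muln_gt0; lia.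
apply: trivial_iso (flatten_weave m0) _.
have := @unknot_shift1 R p _ m0 1; rewrite /= => /(_ _); move=> /(_ ltac:(lia)).
rewrite /shift1; congr trivial_knot; congr flat_closure.
have -> : iota 1 p = 1%N :: iota 2 (p - 1) by case: (p) p_gt2 => //= q _; rewrite subn1.
rewrite /= weave_end1 /= /height /=; [|lia|lia].
congr (_ :: _); apply/eq_in_map => s; rewrite mem_iota => hs.
have /negbTE s1 : s != 1%N by lia.
by rewrite weave_end1 ?s1 //; lia.
Qed.

Lemma trivial_weave2 n : odd p ->
  trivial_knot (braid_closure R p (word_of (weave_index p) (layer_sign p) ((n * p + 2) * p.-1))).
Proof.
move=> op; have m0 : (0 < (n * p + 2) * p.-1)%N by rewrite muln_gt0; lia.
apply: trivial_iso (flatten_weave m0) _.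
have := @unknot_shift2 R p _ m0 1 op ltac:(lia).
rewrite /shift2; congr trivial_knot; congr flat_closure.
have -> : iota 1 p = [:: 1%N, 2 & iota 3 (p - 2)].
  by case: (p) p_gt2 => [|[|q]] //= _; rewrite subn2.
rewrite /= !weave_end2 /= /height /target /level /=; [|lia..].
congr [:: _, _ & _]; apply/eq_in_map => s; rewrite mem_iota => hs.
have /negbTE s1 : s != 1%N by lia.
have /negbTE s2 : s != 2 by lia.
by rewrite weave_end2 ?s1 ?s2 //; lia.
Qed.

Lemma weaving_knot_bound q c : 
  trivial_knot (braid_closure R p (word_of (weave_index p) (layer_sign p) (q * p.-1))) ->
  (\sum_(0 <= r < q) row_cost p r)%N = c ->
  exists2 u, is_unknotting_number (weaving_knot R p q) u & (u <= c)%N.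
Proof.
have p1 : (1 < p)%N by lia.
move=> ht <-; apply: unknotting_number_le; rewrite /weaving_knot weaving_word //.
rewrite -cost_rows //; rewrite -[X in unknotted_by X _]addn0.
by apply: unknotted_changes => //; exact: weave_valid.
Qed.

End Layered.
End UnknottingWeavingKnots.

Theorem theorem1p2 (R : realType) :
  (forall p : nat, odd p -> (3 <= p)%N ->
     (forall n : nat, (0 < n)%N ->
        exists2 u : nat,
          is_unknotting_number (weaving_knot R p (n * p + 1)) u &
          u%:R <= n%:R * (p%:R ^+ 2 - 1) / 4 :> rat)
     /\
     (forall n : nat,
        exists2 u : nat,
          is_unknotting_number (weaving_knot R p (n * p + 2)) u &
          u%:R <= n%:R * (p%:R ^+ 2 - 1) / 4 + (p%:R - 1) / 2 :> rat))
  /\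
  (forall p : nat, ~~ odd p -> (4 <= p)%N ->
     forall n : nat, (0 < n)%N ->
       exists2 u : nat,
         is_unknotting_number (weaving_knot R p (n * p + 1)) u &
         u%:R <= n%:R * p%:R * (p%:R - 1) / 2 :> rat).
Proof.
have row0 p : (1 < p)%N -> (\sum_(0 <= r < 1) row_cost p r = 0)%N.
  by move=> p1; rewrite big_nat1 row_cost0.
split=> [p op p3|p ep p4 n _].
  have [M eM] : exists M, p = M.*2.+1 by exists p./2; have := odd_double_half p; rewrite op.
  have p1 : (1 < p)%N by exact: ltnW.
  have pM : p%:R = 2 * M%:R + 1 :> rat by rewrite eM -natr1 -muln2 natrM mulrC.
  have bound n : (n * (M * M.+1))%:R = n%:R * (p%:R ^+ 2 - 1) / 4 :> rat.
    by rewrite pM !natrM -natr1; field.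
  split=> n.
    move=> _; have [u hu uc] := weaving_knot_bound (R := R) p3 (trivial_weave1 p3 n) erefl.
    exists u => //; rewrite -bound ler_nat.
    by move: uc; rewrite cost_blocks (row0 _ p1) addn0 (block_cost_odd p1 eM).
  have [u hu uc] := weaving_knot_bound (R := R) p3 (trivial_weave2 p3 n op) erefl.
  exists u => //.
  have -> : (p%:R - 1) / 2 = M%:R :> rat by rewrite pM; field.
  rewrite -bound -natrD ler_nat; move: uc; rewrite cost_blocks (block_cost_odd p1 eM).
  by rewrite big_nat_recr //= (row0 _ p1) add0n (row_cost1 p1 eM).
have p3 : (2 < p)%N by exact: ltnW.
have p1 : (1 < p)%N by exact: ltnW.
have [u hu uc] := weaving_knot_bound (R := R) p3 (trivial_weave1 p3 n) erefl.
exists u => //; rewrite ler_pdivlMr //.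
have -> : p%:R - 1 = p.-1%:R :> rat by rewrite -subn1 natrB // ltnW.
rewrite -!natrM ler_nat -mulnA -(block_cost_even p1 ep) mulnCA mulnC.
by rewrite leq_pmul2l //; move: uc; rewrite cost_blocks (row0 _ p1) addn0.
Qed.
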